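(* Let $n\ge 0$ be an integer. A compactum $X$ is a cell-like (resp., $UV^n$) space if and only if $X$ is the limit space of a $\sigma$-complete inverse system consisting of cell-like (resp., $UV^n$) metric compacta.
   Context: All maps are continuous. A compactum is a compact Hausdorff space (not necessarily metrizable). $\mathbb S^k$ is the $k$-sphere. $ANR$ means absolute neighborhood retract (in the class of metrizable spaces, or in the class of compact Hausdorff spaces, respectively). A closed subset $F$ of a space $Y$ is $UV^n$ in $Y$ if every neighborhood $U$ of $F$ in $Y$ contains a neighborhood $V$ of $F$ such that, for each $0\le k\le n$, every map $\mathbb S^k\to V$ is null-homotopic in $U$. A closed subset $F\subset Y$ is cell-like in $Y$ if $F$ is contractible in every neighborhood of $F$ in $Y$. A space is $UV^n$ (resp., cell-like) if it is $UV^n$ (resp., cell-like) in some $ANR$-space containing it as a closed set (for metrizable or compact spaces this does not depend on the choice of the $ANR$-space). An inverse system $\{X_\alpha,p^\beta_\alpha,\ \alpha<\beta,\ \alpha,\beta\in A\}$ over a directed partially ordered set $A$ is $\sigma$-complete if every countable chain $\gamma(1)<\gamma(2)<\dots$ in $A$ has a supremum $\gamma\in A$, and for every such chain $X_\gamma$ is canonically (via the maps $p^{\gamma}_{\gamma(k)}$) the limit of the inverse sequence $\{X_{\gamma(k)},p^{\gamma(k+1)}_{\gamma(k)}\}$. *)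

(* Defs.v *)
From HB Require Import structures.
From mathcomp Require Import all_boot all_order all_algebra.
From mathcomp Require Import all_classical all_reals all_analysis.

Set Implicit Arguments.
Unset Strict Implicit.
Unset Printing Implicit Defensive.

Import Order.TTheory GRing.Theory Num.Theory.
Import numFieldNormedType.Exports.

Local Open Scope classical_set_scope.
Local Open Scope ring_scope.

Definition homeomorphism (X Y : topologicalType) (f : X -> Y) : Prop :=
  exists g : Y -> X, [/\ cancel f g, cancel g f, continuous f & continuous g].

(* The second conjunct says that X carries the topology induced by e. *)
Definition closed_embedding (X Y : topologicalType) (e : X -> Y) : Prop :=
  [/\ injective e,
      forall A : set X, open A <-> exists2 B : set Y, open B & e @^-1` B = A
    & closed (range e)].

Definition compactum (X : topologicalType) : Prop :=
  compact [set: X] /\ hausdorff_space X.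

Definition metrizable (R : realType) (X : topologicalType) : Prop :=
  exists (M : metricType R) (f : X -> M), homeomorphism f.

(* Absolute neighborhood retracts in a class C of spaces; the retraction of the
   neighborhood W is given with values in Y instead of range e. *)
Definition ANR_in (C : topologicalType -> Prop) (Y : topologicalType) : Prop :=
  C Y /\
  forall (Z : topologicalType) (e : Y -> Z), C Z -> closed_embedding e ->
    exists2 W : set Z, set_nbhs (range e) W &
      exists2 r : W -> Y, continuous r &
        forall (w : W) (y : Y), set_val w = e y -> r w = y.

Definition ANR (R : realType) (Y : topologicalType) : Prop :=
  ANR_in (@metrizable R) Y \/ ANR_in compactum Y.

(* f is homotopic, through maps into U, to a constant map.  The conjunct U c
   only matters when S is empty. *)
Definition null_homotopic_in (R : realType) (S Y : topologicalType)
    (U : set Y) (f : S -> Y) : Prop :=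
  exists (H : S * R -> Y) (c : Y),
    [/\ {within [set: S] `*` `[0, 1], continuous H},
        forall s t, t \in `[0, 1] -> U (H (s, t)),
        forall s, H (s, 0) = f s,
        forall s, H (s, 1) = c
      & U c].

(* The Euclidean unit sphere of dimension k. *)
Definition sphere (R : realType) (k : nat) : set 'rV[R]_k.+1 :=
  [set x : 'rV[R]_k.+1 | \sum_i x 0 i ^+ 2 = 1].
Arguments sphere : clear implicits.

Definition UV_in (R : realType) (n : nat) (Y : topologicalType) (F : set Y)
    : Prop :=
  closed F /\
  forall U : set Y, set_nbhs F U ->
    exists V : set Y, [/\ set_nbhs F V, V `<=` U
      & forall k, (k <= n)%N ->
        forall f : sphere R k -> Y, continuous f -> range f `<=` V ->
          null_homotopic_in R U f].

Definition cell_like_in (R : realType) (Y : topologicalType) (F : set Y)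
    : Prop :=
  closed F /\
  forall U : set Y, set_nbhs F U ->
    null_homotopic_in R U (set_val : F -> Y).

Definition UV_space (R : realType) (n : nat) (X : topologicalType) : Prop :=
  exists (Y : topologicalType) (e : X -> Y),
    [/\ ANR R Y, closed_embedding e & UV_in R n (range e)].

Definition cell_like_space (R : realType) (X : topologicalType) : Prop :=
  exists (Y : topologicalType) (e : X -> Y),
    [/\ ANR R Y, closed_embedding e & cell_like_in R (range e)].

Record inverse_system (d : Order.disp_t) (A : porderType d) := InverseSystem {
  stage :> A -> topologicalType;
  bond : forall a b : A, (a < b)%O -> stage b -> stage a;
  bond_continuous : forall (a b : A) (ab : (a < b)%O), continuous (bond ab);
  bond_comp : forall (a b c : A) (ab : (a < b)%O) (bc : (b < c)%O)
    (ac : (a < c)%O) (x : stage c), bond ac x = bond ab (bond bc x)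
}.

Definition directed (d : Order.disp_t) (A : porderType d) : Prop :=
  [set: A] !=set0 /\ forall a b : A, exists2 c, (a <= c)%O & (b <= c)%O.

Definition inverse_limit (d : Order.disp_t) (A : porderType d)
    (S : inverse_system A) : set (prod_topology (stage S)) :=
  [set x | forall (a b : A) (ab : (a < b)%O), bond ab (x b) = x a].
Arguments inverse_limit {d A} S.

Definition sequence_limit (K : nat -> topologicalType)
    (q : forall k, K k.+1 -> K k) : set (prod_topology K) :=
  [set x | forall k, q k (x k.+1) = x k].

(* The upper bound is required to be strict only in order to have the maps
   bond (ub k); for a strictly increasing chain any upper bound is strict. *)
Definition sigma_complete (d : Order.disp_t) (A : porderType d)
    (S : inverse_system A) : Prop :=
  forall (c : nat -> A) (cS : forall k, (c k < c k.+1)%O),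
    exists (g : A) (ub : forall k, (c k < g)%O),
      (forall b : A, (forall k, (c k <= b)%O) -> (g <= b)%O) /\
      exists2 h : S g -> sequence_limit (fun k => @bond _ _ S _ _ (cS k)),
        homeomorphism h & forall x k, set_val (h x) k = bond (ub k) x.

(* X is the limit space of a sigma-complete inverse system, over a directed
   partially ordered set, of metric compacta with the property P. *)
Definition sigma_limit_of (R : realType) (P : topologicalType -> Prop)
    (X : topologicalType) : Prop :=
  exists (d : Order.disp_t) (A : porderType d) (S : inverse_system A),
    [/\ directed A, sigma_complete S,
        forall a, [/\ compactum (S a), metrizable R (S a) & P (S a)]
      & exists h : X -> inverse_limit S, homeomorphism h].

(* Main.v *)
Require Import Defs.
From HB Require Import structures.
From mathcomp Require Import all_boot all_order all_algebra.
From mathcomp Require Import all_classical all_reals all_analysis.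
From mathcomp Require Import lra.

(** A compactum X is studied through an embedding into a power R^T of the real
    line whose image lies in the cube [0,1]^T. In R^T every
    neighborhood of a compact set contains one that depends on finitely many
    coordinates, maps can be joined along segments, and Tietze's theorem
      extends maps coordinate by coordinate.

    Fix a class of test spaces. The property [UV_near] asks that every
    neighborhood U of a set contain a neighborhood V such that every map of a
    test space into V is null-homotopic in U. When the tests are the spheres of
    dimension at most n this is UV^n; when they are all spaces it is
    cell-likeness, because a contraction of X in U extends to a contraction in
    U of a whole neighborhood of X ([contracts_near]). Both equivalences of the
    theorem thus become one statement about [UV_shape].

    The property moves from a set X' in a space Y to a set X in R^T as soon as
    there are a map alpha from a neighborhood of X to Y with alpha(X) in X' and
    a map beta from Y to R^T such that the segments from x to beta(alpha(x))
    stay in U: a map into a small neighborhood of X is homotopic to its image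
    under beta o alpha, which contracts because its image under alpha does
    ([contracts_transfer], [UV_transfer]). Taking X' = X gives the independence
    of the ambient space: beta comes from Tietze's theorem and alpha from the
    extension property of ANRs ([ANR_extensor]). In the compact case the latter
    holds because Y is a neighborhood retract of a cube. In the metrizable case
    Y is a neighborhood retract of a metric space in which an image of the
    compactum Z, on which an extension is wanted, is glued to Y along the
    compact set where the map is already defined ([glue_map],
      [kappa_embedding]).

    Let X be the limit of a system of compacta S a that have the property. The
    functions of the stages, composed with the projections, embed X in some
    R^T, and a neighborhood U of X depends on finitely many of them, hence on a
    single stage. A compactness argument ([limit_escape]) yields a later stage
    S c which is mapped entirely into U, and the property of S c is
    transferred to X ([limit_UV_shape]).

    Conversely let X in R^T have the property. For a countable subset B of T
    the shadow of X over B, its projection to the coordinates in B, is a metric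
    compactum. Basic neighborhoods of X are described by a finite set of
    coordinates and an integer, and the property assigns to each of them a
    smaller one. If B is closed under this assignment, then the shadow over B
    has the property again ([shadow_UV]). Every countable set of coordinates
    lies in a countable closed one, and an increasing union of a sequence of
    countable closed sets is of the same kind, so the shadows over such sets
    form a sigma-complete system. Its limit is X, since a coherent family of
    points in the shadows comes from a point of X ([shadow_glue]). *)

Set Implicit Arguments.
Unset Strict Implicit.
Unset Printing Implicit Defensive.

Import Order.TTheory GRing.Theory Num.Theory.
Import numFieldNormedType.Exports.

Local Open Scope classical_set_scope.
Local Open Scope ring_scope.

(** * Continuity and the powers of the real line *)

Lemma continuous_compose (X Y Z : topologicalType) (f : X -> Y) (g : Y -> Z) :
  continuous f -> continuous g -> continuous (fun x => g (f x)).
Proof. by move=> cf cg x; apply: (@continuous_comp _ _ _ f g);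
  [exact: cf|exact: cg]. Qed.

Lemma continuous_pair (X Y Z : topologicalType) (f : X -> Y) (g : X -> Z) :
  continuous f -> continuous g -> continuous (fun x => (f x, g x)).
Proof. by move=> cf cg x; apply: cvg_pair; [exact: cf|exact: cg]. Qed.

Lemma continuous_fst (X Y : topologicalType) : continuous (@fst X Y).
Proof. by move=> p; exact: cvg_fst. Qed.

Lemma continuous_snd (X Y : topologicalType) : continuous (@snd X Y).
Proof. by move=> p; exact: cvg_snd. Qed.

Lemma continuous_id (X : topologicalType) : continuous (fun x : X => x).
Proof. by move=> p; exact: cvg_id. Qed.

Lemma continuous_cst (X Y : topologicalType) (y : Y) : continuous (fun _ : X =>
  y).
Proof. by move=> p; exact: cvg_cst. Qed.

Section real_valued.
Context {R : realType} {X : topologicalType}.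
Implicit Types f g : X -> R.

Lemma continuous_add f g : continuous f -> continuous g ->
  continuous (fun x => f x + g x).
Proof. by move=> cf cg x; apply: (@continuousD R R^o);
  [exact: cf|exact: cg]. Qed.

Lemma continuous_sub f g : continuous f -> continuous g ->
  continuous (fun x => f x - g x).
Proof. by move=> cf cg x; apply: (@continuousB R R^o);
  [exact: cf|exact: cg]. Qed.

Lemma continuous_mul f g : continuous f -> continuous g ->
  continuous (fun x => f x * g x).
Proof. by move=> cf cg x; apply: continuousM; [exact: cf|exact: cg]. Qed.

End real_valued.

Definition Rpow (R : realType) (T : Type) : topologicalType :=
  prod_topology (fun _ : T => R : topologicalType).

Lemma continuous_at_prod (I : eqType) (K : I -> topologicalType)
    (S : topologicalType) (f : S -> prod_topology K) s :
  (forall i, {for s, continuous (fun s => f s i)}) -> {for s, continuous f}.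
Proof.
move=> cf; apply/cvg_sup => i.
have surj r : exists z : prod_topology K, z i = r.
  by exists (dfwith (f s) i r); rewrite dfwithin.
apply/cvg_image.
  by rewrite eqEsubset; split=> // r _; have [z zr] := surj r; exists z.
move=> A /= nA; have := cf i _ nA => /= nA'.
exists ((fun z : prod_topology K => z i) @^-1` A) => //.
rewrite eqEsubset; split=> [r [z Az <-]//|r Ar].
by have [z zr] := surj r; exists z => //=; rewrite zr.
Qed.

Lemma continuous_prod (I : eqType) (K : I -> topologicalType)
    (S : topologicalType) (f : S -> prod_topology K) :
  (forall i, continuous (fun s => f s i)) -> continuous f.
Proof. by move=> cf s; apply: continuous_at_prod => i; exact: cf. Qed.

Section Rpow_topology.
Context {R : realType} {T : choiceType}.
Local Notation RT := (Rpow R T).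

Lemma Rpow_proj_continuous (t : T) : continuous (fun z : RT => z t : R).
Proof. exact: (@proj_continuous T (fun _ => R) t). Qed.

Lemma continuous_at_Rpow (S : topologicalType) (f : S -> RT) s :
  (forall t, {for s, continuous (fun s => f s t : R)}) -> {for s, continuous f}.
Proof. exact: continuous_at_prod. Qed.

Lemma continuous_RpowP (S : topologicalType) (f : S -> RT) :
  (forall t, continuous (fun s => f s t : R)) -> continuous f.
Proof. by move=> cf s; apply: continuous_at_Rpow => t; exact: cf. Qed.

Lemma nbhs_RpowP (z : RT) (A : set RT) : nbhs z A <->
  exists (F : seq T) (e : R), 0 < e /\
    forall w : RT, (forall t, t \in F -> `|w t - z t| < e) -> A w.
Proof.
split; last first.
  case=> F [e [e0 FA]].
  have : \forall w \near z, forall t, t \in F -> `|w t - z t| < e.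
    elim: F {FA} => [|t F IH]; first by near=> w.
    have nt : \forall w \near z, `|w t - z t| < e.
      have /cvgrPdist_lt/(_ e e0) := @Rpow_proj_continuous t z.
      by apply: filterS => w; rewrite distrC.
    near=> w => u; rewrite inE => /orP[/eqP ->|].
      by near: w.
    by move: u; near: w.
  by apply: filterS.
pose G : set_system RT := [set B | exists (F : seq T) (e : R), 0 < e /\
    forall w : RT, (forall t, t \in F -> `|w t - z t| < e) -> B w].
have GF : Filter G.
  split=> [|B C [F [e [e0 FB]]] [F' [e' [e'0 FC]]]|B C BC [F [e [e0 FB]]]].
  - by exists [::], 1.
  - exists (F ++ F'), (Num.min e e'); split; first by rewrite lt_min e0.
    move=> w Fw; split; [apply: FB|apply: FC] => t tF;
      have := Fw t; rewrite mem_cat tF ?orbT => /(_ isT);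
      by rewrite lt_min => /andP[].
  - by exists F, e; split=> // w /FB /BC.
suff : G --> z by apply.
apply/cvg_sup => t.
apply/cvg_image; first by rewrite eqEsubset; split=> // r _;
  exists (fun _ => r).
move=> B /nbhs_ballP[e /= e0 eB].
exists ((fun w : RT => w t) @^-1` B).
  exists [:: t], e; split=> // w /(_ t); rewrite inE eqxx => /(_ isT) wz.
  by apply: eB; rewrite /ball /= distrC.
by rewrite eqEsubset; split=> [r [w Bw <-]//|r Br]; exists (fun _ => r).
Unshelve. all: by end_near. Qed.

Lemma Rpow_hausdorff : hausdorff_space RT.
Proof. by apply: (@hausdorff_product T (fun _ => R)) => _;
  exact: Rhausdorff. Qed.

Definition cube : set RT := [set z | forall t, 0 <= z t <= 1].

Lemma cube_compact : compact cube.
Proof.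
have := @tychonoff T (fun _ => R) (fun _ => `[0, 1]%classic)
  (fun _ => @segment_compact R 0 1).
exact.
Qed.

Definition line (x y : RT) (t : R) : RT := fun i => (1 - t) * x i + t * y i.

Lemma line0 x y : line x y 0 = x.
Proof. by apply/funext => i; rewrite /line subr0 mul1r mul0r addr0. Qed.

Lemma linexx x t : line x x t = x.
Proof. by apply/funext => i; rewrite /line -mulrDl subrK mul1r. Qed.

Lemma line_continuous (S : topologicalType) (f g : S -> RT) (h : S -> R) s :
  {for s, continuous f} -> {for s, continuous g} -> {for s, continuous h} ->
  {for s, continuous (fun s => line (f s) (g s) (h s))}.
Proof.
move=> cf cg ch; apply: continuous_at_Rpow => t.
have pr (k : S -> RT) : {for s, continuous k} ->
    {for s, continuous (fun s => k s t : R)}.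
  by move=> ck; apply: (@continuous_comp _ _ _ k (fun z : RT => z t : R)) => //;
    exact: Rpow_proj_continuous.
apply: (@continuousD R R^o); apply: continuousM; try exact: pr.
  by apply: (@continuousB R R^o) => //; exact: cvg_cst.
exact: ch.
Qed.

Lemma line_continuousT (S : topologicalType) (f g : S -> RT) (h : S -> R) :
  continuous f -> continuous g -> continuous h ->
  continuous (fun s => line (f s) (g s) (h s)).
Proof. by move=> cf cg ch s; apply: line_continuous;
  [exact: cf|exact: cg|exact: ch]. Qed.

End Rpow_topology.

(** * Null-homotopies *)

Section homotopy.
Context {R : realType}.

Definition clamp (t : R) : R := Num.min 1 (Num.max 0 t).

Lemma clamp_itv t : 0 <= clamp t <= 1.
Proof. by rewrite /clamp; case: (leP 0 t) => ?;
  [case: (leP 1 t)|case: (leP 1 0)] => ?; lra. Qed.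

Lemma clamp_id t : 0 <= t <= 1 -> clamp t = t.
Proof. by rewrite /clamp => /andP[? ?]; case: (leP 0 t) => ?;
  [case: (leP 1 t)|case: (leP 1 0)] => ?; lra. Qed.

Lemma clamp_le0 t : t <= 0 -> clamp t = 0.
Proof. by rewrite /clamp => ?; case: (leP 0 t) => ?;
  [case: (leP 1 t)|case: (leP 1 0)] => ?; lra. Qed.

Lemma clamp_ge1 t : 1 <= t -> clamp t = 1.
Proof. by rewrite /clamp => ?; case: (leP 0 t) => ?;
  [case: (leP 1 t)|case: (leP 1 0)] => ?; lra. Qed.

Lemma clamp_continuous : continuous clamp.
Proof.
move=> t; apply: (@continuous_min R R (fun _ => 1) (fun t => Num.max 0 t)).
  exact: cvg_cst.
by apply: (@continuous_max R R (fun _ => 0) id); [exact: cvg_cst|exact: cvg_id].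
Qed.

Lemma continuous_comp_within (S Y Z : topologicalType) (D : set Y)
    (g : S -> Y) (f : Y -> Z) : continuous g -> (forall s, D (g s)) ->
  {within D, continuous f} -> continuous (f \o g).
Proof.
move=> cg gD /subspace_continuousP cf s.
move=> A nA; have /cg := cf _ (gD s) A nA.
rewrite !nbhs_simpl /=; apply: filterS => x; exact.
Qed.

(** Clamping the parameter to [0, 1] turns a homotopy on S * [0, 1] into
    a map that is continuous on all of S * R. *)
Lemma null_homotopicP (S Y : topologicalType) (U : set Y) (f : S -> Y) :
  null_homotopic_in R U f <-> exists (H : S * R -> Y) (c : Y),
    [/\ continuous H, forall p, U (H p),
      forall s t, t <= 0 -> H (s, t) = f s,
      forall s t, 1 <= t -> H (s, t) = c & U c].
Proof.
split=> -[H [c [cH UH H0 H1 Uc]]]; last first.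
  exists H, c; split=> //; first exact: continuous_subspaceT.
  - by move=> s; exact: H0.
  - by move=> s; exact: H1.
exists (fun p => H (p.1, clamp p.2)), c; split=> //.
- pose g := (fun p : S * R => (p.1, clamp p.2)).
  have cg : continuous g.
    by apply: continuous_pair; [exact: continuous_fst|exact: continuous_compose
      (@continuous_snd _ _) clamp_continuous].
  have gD q : ([set: S] `*` `[0, 1]) (g q).
    by split=> //=; rewrite in_itv /= clamp_itv.
  exact: (continuous_comp_within cg gD cH).
- by move=> p; apply: UH; rewrite in_itv /= clamp_itv.
- by move=> s t t0; rewrite /= clamp_le0.
- by move=> s t t0; rewrite /= clamp_ge1.
Qed.

Lemma null_homotopic_comp (S Y Z : topologicalType) (U : set Y) (V : set Z)
  (f : S -> Y) (g : Y -> Z) : continuous g -> (forall y, U y -> V (g y)) ->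
  null_homotopic_in R U f -> null_homotopic_in R V (g \o f).
Proof.
move=> cg UV /null_homotopicP[H [c [cH UH H0 H1 Uc]]].
apply/null_homotopicP; exists (g \o H), (g c); split.
- exact: continuous_compose cH cg.
- by move=> p; apply: UV.
- by move=> s t t0 /=; rewrite H0.
- by move=> s t t0 /=; rewrite H1.
- exact: UV.
Qed.

Lemma null_homotopic_precomp (S S' Y : topologicalType) (U : set Y)
  (f : S -> Y) (g : S' -> S) : continuous g ->
  null_homotopic_in R U f -> null_homotopic_in R U (f \o g).
Proof.
move=> cg /null_homotopicP[H [c [cH UH H0 H1 Uc]]].
apply/null_homotopicP; exists (fun p => H (g p.1, p.2)), c; split=> //=.
- apply: (continuous_compose _ cH); apply: continuous_pair;
  last exact: continuous_snd.
  exact: (continuous_compose (@continuous_fst S' R)) cg.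
- by move=> s t t0 /=; rewrite H0.
- by move=> s t t0 /=; rewrite H1.
Qed.

(** The homotopy along segments is followed by the given contraction. *)
Lemma null_homotopic_line (T : choiceType) (S : topologicalType)
    (U : set (Rpow R T)) (f g : S -> Rpow R T) :
  continuous f -> continuous g ->
  (forall s t, 0 <= t <= 1 -> U (line (f s) (g s) t)) ->
  null_homotopic_in R U g -> null_homotopic_in R U f.
Proof.
move=> cf cg Ufg /null_homotopicP[H [c [cH UH H0 H1 Uc]]].
(* The segment is followed at double speed, then H. The second summand vanishes
   on the first half, and cancels the end of the segment on the second half, so
   that a sum replaces a definition by cases. *)
pose K (p : S * R) : Rpow R T := fun i =>
  line (f p.1) (g p.1) (clamp (2 * p.2)) i + (H (p.1, 2 * p.2 - 1) i - g p.1 i).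
have Kle p : p.2 <= 1 / 2 -> K p = line (f p.1) (g p.1) (clamp (2 * p.2)).
  move=> p2; apply/funext => i; rewrite /K H0 ?subrr ?addr0//; lra.
have Kge p : 1 / 2 <= p.2 -> K p = H (p.1, 2 * p.2 - 1).
  move=> p2; apply/funext => i; rewrite /K clamp_ge1; last lra.
  by rewrite /line subrr mul0r add0r mul1r addrC subrK.
apply/null_homotopicP; exists K, c; split=> //.
- have c2 : continuous (fun p : S * R => 2 * p.2).
    by apply: continuous_mul; [exact: continuous_cst|exact: continuous_snd].
  apply: continuous_RpowP => i.
  have pr (k : S * R -> Rpow R T) : continuous k ->
    continuous (fun s => k s i : R).
    by move=> ck; exact: (continuous_compose ck (@Rpow_proj_continuous R T i)).
  apply: continuous_add.
    apply: (pr (fun p => line (f p.1) (g p.1) (clamp (2 * p.2)))).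
    by apply: line_continuousT;
      [exact: (continuous_compose (@continuous_fst S R)) cf|
      exact: (continuous_compose (@continuous_fst S R)) cg|exact:
        continuous_compose c2 clamp_continuous].
  apply: continuous_sub; last by apply: (pr (fun p => g p.1));
    exact: (continuous_compose (@continuous_fst S R)) cg.
  apply: (pr (fun p => H (p.1, 2 * p.2 - 1))); apply: (continuous_compose _ cH).
  by apply: continuous_pair; [exact: continuous_fst|apply: continuous_sub;
    [exact: c2|exact: continuous_cst]].
- move=> p; case: (leP p.2 (1 / 2)) => p2; first by rewrite Kle//;
  apply/Ufg/clamp_itv.
  by rewrite Kge// ltW.
- move=> s t t0; rewrite Kle /=; last lra.
  by rewrite clamp_le0 ?line0//; lra.
- by move=> s t t1; rewrite Kge /= ?H1//; lra.
Qed.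

End homotopy.

(** * Compact spaces and the Tietze extension *)

Section compact_spaces.

(** The tube lemma; it is applied both to the parameter interval of a
    homotopy and to a compactum. *)
Lemma tube (A S Y : topologicalType) (K : set S) (F : A * S -> Y) (U : set Y)
    (a : A) :
  compact K -> open U -> (forall s, K s -> {for (a, s), continuous F}) ->
  (forall s, K s -> U (F (a, s))) ->
  \forall a' \near a, forall s, K s -> U (F (a', s)).
Proof.
move=> /compact_near_coveringP cK oU cF UF.
apply: (cK _ (nbhs a) (fun a' s => U (F (a', s)))) => s Ks.
have /(cF s Ks) : nbhs (F (a, s)) U by apply: open_nbhs_nbhs; split=> //;
  exact: UF.
rewrite nbhs_simpl /= => -[[P Q] /= [Pa Qs] PQ].
by exists (Q, P) => //= -[s' a'] [Qs' Pa']; apply: (PQ (a', s')).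
Qed.

Lemma closed_map (X Y : topologicalType) (f : X -> Y) (A : set X) :
  compact [set: X] -> hausdorff_space Y -> continuous f -> closed A ->
  closed (f @` A).
Proof.
move=> cX hY cf clA; apply: compact_closed => //.
apply: continuous_compact; first exact: continuous_subspaceT.
exact: subclosed_compact clA cX _.
Qed.

Lemma compact_closed_embedding (X Y : topologicalType) (f : X -> Y) :
  compact [set: X] -> hausdorff_space Y -> continuous f -> injective f ->
  closed_embedding f.
Proof.
move=> cX hY cf injf; split=> //; last exact: closed_map closedT.
move=> A; split=> [oA|[B oB <-]]; last by apply: open_comp => // x _; exact: cf.
exists (~` (f @` ~` A)).
  by apply/closed_openC/closed_map => //; exact: open_closedC.
rewrite eqEsubset; split=> x /=.
  by move=> nA; apply: contrapT => Ax; apply: nA; exists x.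
by move=> Ax [y nAy /injf yx]; apply: nAy; rewrite yx.
Qed.

Lemma compact_homeomorphism (X Y : topologicalType) (f : X -> Y) :
  compact [set: X] -> hausdorff_space Y -> continuous f -> injective f ->
  (forall y, exists x, f x = y) -> homeomorphism f.
Proof.
move=> cX hY cf injf /choice[g fg]; exists g; split=> //.
  by move=> x; apply: injf; rewrite fg.
apply/continuousP => A oA.
have [_ /(_ A)[/(_ oA)[B oB <-] _] _] := compact_closed_embedding cX hY cf injf.
by rewrite -comp_preimage (_ : f \o g = id) //; apply/funext => y /=.
Qed.

Lemma set_val_continuous (X : topologicalType) (A : set X) :
  continuous (set_val : A -> X).
Proof. exact: initial_continuous. Qed.

Lemma continuous_set_type (S X : topologicalType) (A : set X) (f : S -> A) :
  continuous (fun s => set_val (f s)) -> continuous f.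
Proof. exact: continuous_comp_initial. Qed.

Lemma set_val_in (X : Type) (A : set X) (x : A) : A (set_val x).
Proof. exact: set_valP. Qed.

Lemma set_type_ex (X : Type) (A : set X) (x : X) : A x ->
  exists a : A, set_val a = x.
Proof. by move=> Ax; exists (exist _ x (mem_set Ax)). Qed.

Lemma continuous_injective_hausdorff (X Y : topologicalType) (f : X -> Y) :
  hausdorff_space Y -> continuous f -> injective f -> hausdorff_space X.
Proof.
move=> hY cf injf p q pq; apply/injf/hY => A B nA nB.
have [x [Ax Bx]] := pq _ _ (cf p A nA) (cf q B nB).
by exists (f x).
Qed.

Lemma set_val_inj (X : Type) (A : set X) : injective (set_val : A -> X).
Proof. exact: val_inj. Qed.

Lemma set_type_hausdorff (X : topologicalType) (A : set X) :
  hausdorff_space X -> hausdorff_space A.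
Proof.
move=> hX; apply: continuous_injective_hausdorff hX _ _.
  exact: set_val_continuous.
exact: set_val_inj.
Qed.

Lemma set_type_compact (X : topologicalType) (A : set X) :
  compact A -> compact [set: A].
Proof.
move=> cA F FF _.
have [x [Ax cx]] : A `&` cluster (set_val @ F) !=set0.
  by apply: cA; rewrite /= nbhs_simpl; apply: filterE => a; exact: set_val_in.
have [a ax] := set_type_ex Ax; exists a;
  split=> // B C FB [D [[E oE <-] Ea] DC].
have : (set_val @` B) `&` E !=set0.
  apply: cx; first by rewrite /= nbhs_simpl; apply: filterS FB => b Bb;
    exists b.
  by apply: open_nbhs_nbhs; split=> //; rewrite -ax.
by move=> [_ [[b Bb <-] Eb]]; exists b; split=> //; exact: DC.
Qed.

Lemma set_type_compactum (X : topologicalType) (A : set X) :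
  compact A -> hausdorff_space X -> compactum A.
Proof. by move=> ? ?; split; [exact: set_type_compact|exact:
  set_type_hausdorff]. Qed.

Lemma closed_embedding_continuous (X Y : topologicalType) (f : X -> Y) :
  closed_embedding f -> continuous f.
Proof.
by move=> [_ oA _]; apply/continuousP => B oB; apply/oA; exists B.
Qed.

End compact_spaces.

Section tietze.
Context {R : realType}.

(** Tietze's theorem for a function given on the source of a closed
    embedding; compactness of X bounds the function. *)
Lemma tietze_extension (X Y : topologicalType) (e : X -> Y) (phi : X -> R) :
  compact [set: X] -> normal_space Y -> closed_embedding e -> continuous phi ->
  exists g : Y -> R, continuous g /\ forall x, g (e x) = phi x.
Proof.
move=> cX nY [ei eo ec] cphi.
have [[x0 _]|X0] := pselect ([set: X] !=set0); last first.
  exists (fun _ => 0); split; first exact: continuous_cst.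
  by move=> x; exfalso; apply: X0; exists x.
(* The inverse of e on its range, with the default value x0. *)
pose inv y := xget x0 [set x | e x = y].
have invK x : inv (e x) = x.
  by apply: ei; apply: (@xgetPex _ x0 [set z | e z = e x]); exists x.
have cpsi : {within range e, continuous (phi \o inv : Y -> R^o)}.
  apply/subspace_continuousP => _ [x _ <-] A nA.
  have nA' : nbhs (phi x) A by move: nA; rewrite /from_subspace /= invK.
  have : nbhs x (phi @^-1` A) := cphi x A nA'.
  rewrite nbhsE => -[B [/eo[C oC eC] Bx] BA].
  have nC : nbhs (e x) C.
    by apply: open_nbhs_nbhs; split=> //; have : (e @^-1` C) x by rewrite eC.
  suff : within (range e) (nbhs (e x)) ((phi \o inv) @^-1` A) by [].
  apply: filterS nC => y Cy [z _ zy]; rewrite -zy /= invK.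
  by apply: BA; rewrite -eC /= zy.
have [M [_ Mphi]] : bounded_set (range (phi : X -> R^o)).
  apply: compact_bounded; apply: continuous_compact => //.
  exact: continuous_subspaceT.
pose M' := Num.max 1 (M + 1).
have M'0 : 0 < M' by rewrite /M' lt_max ltr01.
have bd y : range e y -> `|(phi \o inv) y| <= M'.
  move=> [x _ <-] /=; rewrite invK; apply: Mphi; last by exists x.
  by rewrite /M' lt_max ltrDl ltr01 orbT.
have [g [geq cg _]] := continuous_bounded_extension nY ec M'0 cpsi bd.
exists g; split=> // x; have := geq (e x); rewrite inE /= invK => <- //.
by exists x.
Qed.

Context {T : choiceType}.
Local Notation RT := (Rpow R T).

Lemma clamp_cube (z : RT) : cube (fun t => clamp (z t)).
Proof. by move=> t; exact: clamp_itv. Qed.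

(** The coordinatewise retraction of R^T onto the cube. *)
Definition to_cube (z : RT) : @cube R T :=
  exist (fun z : RT => z \in cube) _ (mem_set (clamp_cube z)).

Lemma to_cube_id (z : RT) : cube z -> set_val (to_cube z) = z.
Proof. by move=> cz; apply/funext => t; exact: clamp_id. Qed.

Lemma to_cube_continuous : continuous to_cube.
Proof.
apply: continuous_set_type; apply: continuous_RpowP => t.
exact: (continuous_compose (@Rpow_proj_continuous R T t) clamp_continuous).
Qed.

Lemma cube_compactum : compactum (@cube R T).
Proof. exact: set_type_compactum cube_compact Rpow_hausdorff. Qed.

Lemma Rpow_extension (X Y : topologicalType) (e : X -> Y) (phi : X -> RT) :
  compact [set: X] -> normal_space Y -> closed_embedding e -> continuous phi ->
  exists g : Y -> RT, continuous g /\ forall x, g (e x) = phi x.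
Proof.
move=> cX nY ee cphi.
have /choice[g gP] : forall t, exists g : Y -> R, continuous g /\
    forall x, g (e x) = phi x t.
  move=> t; apply: tietze_extension => //.
  exact: (continuous_compose cphi (@Rpow_proj_continuous R T t)).
exists (fun y t => g t y); split; first by apply: continuous_RpowP => t;
  case: (gP t).
by move=> x; apply/funext => t; case: (gP t).
Qed.

End tietze.

(** * Metrizability of Hausdorff pseudometric spaces *)

Section truncated_distance.
Context {R : realType} {M : pseudoMetricType R}.
Implicit Types x y z : M.

(** Truncation makes the pseudodistance finite also between points that
    lie in no common ball. *)
Definition trunc_dist x y : R := fine (Order.min 1%:E (edist (x, y))).

Lemma trunc_distE x y : (trunc_dist x y)%:E = Order.min 1%:E (edist (x, y)).
Proof.
rewrite /trunc_dist fineK// fin_numElt; apply/andP; split.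
  by rewrite lt_min ltNyr /= (lt_le_trans _ (edist_ge0 _)).
by rewrite gt_min ltry.
Qed.

Lemma trunc_dist_lt_ball x y (e : R) : e <= 1 -> trunc_dist x y < e ->
  ball x e y.
Proof.
move=> e1; rewrite -lte_fin trunc_distE gt_min lte_fin => /orP[|].
  by rewrite ltNge e1.
exact: (@edist_lt_ball _ _ _ (x, y)).
Qed.

Lemma ball_trunc_dist x y (e : R) : 0 < e -> ball x e y -> trunc_dist x y <= e.
Proof.
move=> e0 xy; rewrite -lee_fin trunc_distE ge_min.
by rewrite (@edist_fin _ _ _ (x, y)) ?orbT.
Qed.

Lemma trunc_dist_sym x y : trunc_dist x y = trunc_dist y x.
Proof. by rewrite /trunc_dist edist_sym. Qed.

Lemma trunc_dist_ge0 x y : 0 <= trunc_dist x y.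
Proof. by rewrite -lee_fin trunc_distE le_min lee01 edist_ge0. Qed.

Lemma trunc_distxx x : trunc_dist x x = 0.
Proof.
apply/eqP; rewrite eq_le trunc_dist_ge0 andbT; apply/ler_addgt0Pl => e e0.
by rewrite addr0; apply: ball_trunc_dist => //; exact: ballxx.
Qed.

Lemma trunc_dist_triangle y x z :
  trunc_dist x z <= trunc_dist x y + trunc_dist y z.
Proof.
rewrite -lee_fin EFinD !trunc_distE.
have [xy1|xy1] := leP 1%:E (edist (x, y)).
  rewrite (@le_trans _ _ 1%:E) ?ge_min ?lexx//.
  by rewrite -[leLHS]adde0 leeD// le_min lee01 edist_ge0.
have [yz1|yz1] := leP 1%:E (edist (y, z)).
  rewrite (@le_trans _ _ 1%:E) ?ge_min ?lexx//.
  by rewrite -[leLHS]add0e leeD// edist_ge0.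
by rewrite (le_trans _ (edist_triangle x y z))// ge_min lexx orbT.
Qed.

Lemma trunc_dist0 x y : hausdorff_space M -> trunc_dist x y = 0 -> x = y.
Proof.
move=> hM xy0; apply: hM => A B Ax /nbhs_ballP[e /= e0 eB].
exists x; split; first exact: nbhs_singleton.
apply/eB/ball_sym/(@le_ball _ _ _ (Num.min 1 e));
  first by rewrite ge_min lexx orbT.
apply: trunc_dist_lt_ball; first by rewrite ge_min lexx.
by rewrite xy0 lt_min ltr01.
Qed.

(** A copy of M whose topology is generated anew by the truncated
    distance. *)
Definition metrized (hM : hausdorff_space M) : Type := M.

Context (hM : hausdorff_space M).

HB.instance Definition _ := Choice.on (metrized hM).
HB.instance Definition _ := isMetric.Build R (metrized hM) trunc_distxx
  (fun x y => @trunc_dist0 x y hM) trunc_dist_sym trunc_dist_triangle.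

(** Small balls of the truncated distance and of M contain each other
    after shrinking. *)
Lemma pseudometric_metrizable : metrizable R M.
Proof.
exists (metrized hM), (id : M -> metrized hM); exists id; split=> //.
- move=> x A /= /nbhs_ballP[e /= e0 eA].
  apply/nbhs_ballP; exists (e / 2) => /=; first by rewrite divr_gt0.
  move=> y xy; apply: eA; rewrite ballEmdist /= /mdist /=.
  apply: (le_lt_trans (ball_trunc_dist _ xy)); first by rewrite divr_gt0.
  by rewrite ltr_pdivrMr// ltr_pMr// ltr1n.
- move=> x A /= /nbhs_ballP[e /= e0 eA].
  apply/nbhs_ballP; exists (Num.min 1 e) => /=; first by rewrite lt_min ltr01.
  move=> y; rewrite ballEmdist /= => xy; apply: eA.
  apply: (@le_ball _ _ _ (Num.min 1 e)); first by rewrite ge_min lexx orbT.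
  by apply: trunc_dist_lt_ball => //; rewrite ge_min lexx.
Qed.

End truncated_distance.

Lemma metrizable_homeomorphic (R : realType) (X Y : topologicalType) (f : X ->
  Y) :
  homeomorphism f -> metrizable R Y -> metrizable R X.
Proof.
move=> [g [fg gf cf cg]] [M [h [k [hk kh ch ck]]]].
exists M, (h \o f); exists (g \o k); split.
- by move=> x /=; rewrite hk fg.
- by move=> x /=; rewrite gf kh.
- exact: (continuous_compose cf ch).
- exact: (continuous_compose ck cg).
Qed.

Lemma metrizable_normal (R : realType) (X : topologicalType) :
  metrizable R X -> normal_space X.
Proof.
move=> [M [h [k [hk kh ch ck]]]] A clA B /set_nbhsP[C [oC AC CB]].
have nM : normal_space M := pseudometric_normal.
have [] := nM (k @^-1` A) _ (k @^-1` C).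
- by apply: preimage_closed => // x _; exact: ck.
- by apply/set_nbhsP; exists (k @^-1` C); split=> //;
  [apply: open_comp => // x _; exact: ck|move=> x; exact: AC].
move=> D /set_nbhsP[E [oE AE ED]] DC.
exists (h @^-1` D).
  apply/set_nbhsP; exists (h @^-1` E); split=> //.
  - by apply: open_comp => // x _; exact: ch.
  - by move=> x Ax; apply: AE => /=; rewrite hk.
  - by move=> x /=; exact: ED.
have hDC : h @^-1` closure D `<=` C by move=> x /DC /=; rewrite hk.
have cl : closed (h @^-1` closure D).
  by apply: preimage_closed; [move=> x _; exact: ch|exact: closed_closure].
apply: subset_trans CB; apply: subset_trans hDC.
rewrite [X in _ `<=` X](closure_id _).1//; apply: closureS => x /=.
exact: subset_closure.
Qed.

(** * Extending maps of compacta into absolute neighborhood retracts *)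

Section canonical_embedding.
Context {R : realType} {X : topologicalType}.

Definition unit_fun := {f : X -> R | continuous f /\ forall x, 0 <= f x <= 1}.

Definition unit_eval (x : X) : Rpow R {classic unit_fun} :=
  fun f : unit_fun => sval f x.

Lemma unit_eval_continuous : continuous unit_eval.
Proof. by apply: continuous_RpowP => -[f [cf fI]]; exact: cf. Qed.

Lemma unit_eval_cube x : cube (unit_eval x).
Proof. by move=> [f [cf fI]]; exact: fI. Qed.

Lemma unit_fun_separates (x y : X) : compactum X -> x <> y ->
  exists f : unit_fun, sval f x = 0 /\ sval f y = 1.
Proof.
move=> [cX hX] xy.
have cl1 (z : X) : closed [set z].
  by apply: (accessible_closed_set1 (hausdorff_accessible hX)).
have [|f [cf fx fy fI]] := @urysohn_ext_itv X R (compact_normal hX cX)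
    [set x] [set y] 0 1 (cl1 x) (cl1 y) _ ltr01.
  by rewrite -subset0 => z [-> /xy].
have fI' z : 0 <= f z <= 1.
  by have := fI (f z); rewrite /= in_itv; apply; exists z.
exists (exist _ f (conj cf fI')) => /=.
by split; [apply: fx; exists x|apply: fy; exists y].
Qed.

Lemma unit_eval_injective : compactum X -> injective unit_eval.
Proof.
move=> hX x y xy; apply: contrapT => /(unit_fun_separates hX)[f [fx fy]].
have := congr1 (fun z : Rpow R {classic unit_fun} => z f) xy.
by rewrite /unit_eval fx fy => /esym/eqP; rewrite oner_eq0.
Qed.

End canonical_embedding.

Section extensor.

Lemma prod_compactum (X Y : topologicalType) :
  compactum X -> compactum Y -> compactum (X * Y)%type.
Proof.
move=> [cX hX] [cY hY]; split; first by rewrite -setXTT; exact: compact_setX.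
move=> p q pq.
have h (Z : topologicalType) (g : X * Y -> Z) : hausdorff_space Z ->
    continuous g -> g p = g q.
  move=> hZ cg; apply: hZ => A B nA nB.
  have [x [Ax Bx]] := pq _ _ (cg p A nA) (cg q B nB).
  by exists (g x).
move: (h _ _ hX (@continuous_fst X Y)) (h _ _ hY (@continuous_snd X Y)).
by case: p q {pq h} => [? ?] [? ?] /= -> ->.
Qed.

(** An extension G of e' o f to Z, followed by a neighborhood retraction
    of Z' onto Y, is an extension of f near e(X); y0 is a default value away
    from there. *)
Lemma neighborhood_extension (X Y Z Z' : topologicalType)
    (e : X -> Z) (f : X -> Y) (e' : Y -> Z') (G : Z -> Z')
    (W0 : set Z') (r : W0 -> Y) (y0 : Y) :
  (forall x, G (e x) = e' (f x)) -> continuous G ->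
  set_nbhs (range e') W0 -> continuous r ->
  (forall w y, set_val w = e' y -> r w = y) ->
  exists (W : set Z) (s : Z -> Y), [/\ open W, range e `<=` W,
    forall w, W w -> {for w, continuous s} & forall x, s (e x) = f x].
Proof.
move=> Gef cG /set_nbhsP[C [oC eC CW0]] cr rK.
pose s z := if pselect (W0 (G z)) is left h
  then r (exist (fun z => z \in W0) _ (mem_set h)) else y0.
have sE z (w : W0) : set_val w = G z -> s z = r w.
  move=> wz; rewrite /s; case: pselect => [h|[]]; last first.
    by rewrite -wz; exact: set_val_in.
  by congr r; apply: set_val_inj; rewrite wz.
exists (G @^-1` C), s; split.
- by apply: open_comp => // x _; exact: cG.
- by move=> _ [x _ <-] /=; rewrite Gef; apply: eC; exists (f x).
- move=> z Cz A nA.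
  have [w wz] := set_type_ex (CW0 _ Cz).
  rewrite (sE _ _ wz) in nA.
  have [D [[E oE <-] Ew] DA] := cr w A nA.
  have nE : nbhs z (G @^-1` (E `&` C)).
    apply: cG; apply: open_nbhs_nbhs; split; first exact: openI.
    by split=> //; rewrite -wz.
  suff : nbhs z (s @^-1` A) by [].
  apply: filterS nE => z' /= [Ez' Cz'].
  have [w' wz'] := set_type_ex (CW0 _ Cz').
  by rewrite (sE _ _ wz'); apply: DA => /=; rewrite wz'.
- move=> x.
  have W0x : W0 (G (e x)) by rewrite Gef; apply: CW0; apply: eC; exists (f x).
  have [w wx] := set_type_ex W0x.
  by rewrite (sE _ _ wx); apply: rK; rewrite wx Gef.
Qed.

(** Y is a neighborhood retract of a cube, and maps into the cube
    extend. *)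
Lemma compact_ANR_extensor (R : realType) (X Y Z : topologicalType)
    (e : X -> Z) (f : X -> Y) (x0 : X) :
  ANR_in compactum Y -> compactum X -> compactum Z -> closed_embedding e ->
  continuous f ->
  exists (W : set Z) (s : Z -> Y), [/\ open W, range e `<=` W,
    forall w, W w -> {for w, continuous s} & forall x, s (e x) = f x].
Proof.
move=> [cY ext] [cX hX] [cZ hZ] ee cf.
pose e' : Y -> @cube R {classic @unit_fun R Y} := to_cube \o unit_eval.
have ce' : continuous e' by exact: (continuous_compose (@unit_eval_continuous R
  Y) to_cube_continuous).
have ie' : injective e'.
  move=> y y' /(congr1 set_val); rewrite /e' /= !to_cube_id;
    try exact: unit_eval_cube.
  exact: unit_eval_injective.
have := ext _ e' cube_compactum
  (compact_closed_embedding (proj1 cY) (proj2 cube_compactum) ce' ie').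
move=> [W0 nW0 [r cr rK]].
have [G [cG Ge]] := Rpow_extension cX (compact_normal hZ cZ) ee
  (continuous_compose cf (@unit_eval_continuous R Y)).
apply: (@neighborhood_extension X Y Z _ e f e' (to_cube \o G) W0 r (f x0)) =>
  //.
- by move=> x /=; rewrite Ge.
- exact: (continuous_compose cG to_cube_continuous).
Qed.

End extensor.

Section metric_extensor.
Context {R : realType} {X Y Z : topologicalType} {M : metricType R}.
Variables (h : Y -> M) (e : X -> Z) (f : X -> Y) (x0 : X) (D : Z * Z -> R).

Let d (y y' : Y) : R := mdist (h y) (h y').

Hypotheses (cX : compact [set: X]) (hh : homeomorphism h).
Hypotheses (ce : continuous e) (cf : continuous f).
Hypotheses (cD : continuous D)
  (De : forall p q, D (e p, e q) = d (f p) (f q)).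

Let d_sym y y' : d y y' = d y' y. Proof. exact: metric_sym. Qed.
Let d_tri y' y y'' : d y y'' <= d y y' + d y' y''.
Proof. exact: metric_triangle. Qed.
Let d_ge0 y y' : 0 <= d y y'. Proof. exact: mdist_ge0. Qed.
Let dxx y : d y y = 0. Proof. exact: mdistxx. Qed.
Let d_eq0 y y' : d y y' = 0 -> y = y'.
Proof. by case: hh => g [hK _ _ _] /mdist_positivity /(can_inj hK). Qed.

Let nbhs_d y A : nbhs y A <-> exists2 r : R, 0 < r & forall y', d y y' < r ->
  A y'.
Proof.
case: hh => g [hK gK ch cg]; split.
  move=> nA; have : nbhs (h y) (g @^-1` A) by apply: cg; rewrite hK.
  move=> /nbhs_ballP[r /= r0 rA]; exists r => // y' yy'.
  by rewrite -[y']hK; apply: rA; rewrite ballEmdist.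
move=> [r r0 rA]; have : nbhs y (h @^-1` ball (h y) r).
  by apply: ch; exact: nbhsx_ballx.
by apply: filterS => y' /=; rewrite ballEmdist => /rA.
Qed.

Let d_lip y y' t : `|d y t - d y' t| <= d y y'.
Proof.
rewrite ler_norml; apply/andP; split.
  by have := d_tri y y' t; rewrite (d_sym y' y); lra.
by have := d_tri y' y t; lra.
Qed.

Definition glue_vals (z : Z) (t : Y) : set R :=
  range (fun q => `|D (z, e q)| + d (f q) t).

(** If D extends the function d (f p) (f q) of p and q, this acts
    as the distance from z to t after Z and Y are glued along X:
    go from z to a point of f(X), then to t. A point of Y has its distance
    function as counterpart (the Kuratowski embedding), and the two
    descriptions agree on X. *)
Definition glue (z : Z) : Y -> R := fun t => inf (glue_vals z t).

Let glue_has_inf z t : has_inf (glue_vals z t).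
Proof.
split; first by exists (`|D (z, e x0)| + d (f x0) t), x0.
by exists 0 => _ [q _ <-]; rewrite addr_ge0.
Qed.

Let glue_le z t q : glue z t <= `|D (z, e q)| + d (f q) t.
Proof. by apply: ge_inf; [case: (glue_has_inf z t)|exists q]. Qed.

Let glue_ge z t (a : R) : (forall q, a <= `|D (z, e q)| + d (f q) t) ->
  a <= glue z t.
Proof.
move=> aq; apply: lb_le_inf; first by case: (glue_has_inf z t).
by move=> _ [q _ <-].
Qed.

Let glue_lt z t (a : R) : glue z t < a ->
  exists q, `|D (z, e q)| + d (f q) t < a.
Proof.
move=> /inf_lt[|_ [q _ <-] ?]; first by case: (glue_has_inf z t).
by exists q.
Qed.

Let glue_e p : glue (e p) = d (f p).
Proof.
apply/funext => t; apply/eqP; rewrite eq_le; apply/andP; split.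
  by have := glue_le (e p) t p; rewrite De dxx normr0 add0r.
by apply: glue_ge => q; rewrite De ger0_norm.
Qed.

Let glue_lip z z' (a : R) t : (forall q, `|D (z, e q) - D (z', e q)| <= a) ->
  `|glue z t - glue z' t| <= a.
Proof.
have one z1 z2 : (forall q, `|D (z1, e q) - D (z2, e q)| <= a) ->
    glue z1 t - glue z2 t <= a.
  move=> Da; rewrite lerBlDr -lerBlDl; apply: glue_ge => q.
  rewrite lerBlDl; apply: (le_trans (glue_le z1 t q)).
  rewrite addrA lerD2r.
  have := ler_distD (D (z2, e q)) (D (z1, e q)) 0; rewrite !subr0.
  by have := Da q; lra.
move=> Da; rewrite ler_norml lerNl opprB one ?one// => q.
by rewrite distrC.
Qed.

(** The function glue z depends on z only through the values D (z, e q),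
    where q runs over a compact space, so that it varies continuously with z
    uniformly in t. *)
Let glue_near z (a : R) : 0 < a ->
  \forall z' \near z, forall t, `|glue z t - glue z' t| <= a.
Proof.
move=> a0; pose F (p : Z * X) : R := `|D (z, e p.2) - D (p.1, e p.2)|.
have cDe (g : Z * X -> Z) : continuous g ->
    continuous (fun p => D (g p, e p.2)).
  move=> cg; refine (continuous_compose (continuous_pair cg _) cD).
  exact: (continuous_compose (@continuous_snd Z X) ce).
have cF : continuous F.
  refine (continuous_compose (continuous_sub _ _) (@norm_continuous R R^o)).
    by apply: cDe; exact: continuous_cst.
  by apply: cDe; exact: continuous_fst.
have UF q : [set: X] q -> [set r : R | r < a] (F (z, q)).
  by move=> _; rewrite /F /= subrr normr0.
apply: filterS (tube cX (@open_lt _ a) (fun s _ => cF (z, s)) UF) => z' Hz' t.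
by apply: glue_lip => q; apply/ltW/Hz'.
Qed.

(** This is what makes Y closed in the glued space. A limit of distance
    functions d y takes arbitrarily small values at the points y, so z is
    close to points of f(X), and by compactness of X one of these has glue z
    as its distance function. *)
Let glue_attained z :
  (forall a, 0 < a -> exists y, forall t, `|glue z t - d y t| < a) ->
  exists q, glue z = d (f q).
Proof.
move=> app.
have app' a : 0 < a -> exists q, forall t, `|glue z t - d (f q) t| <= a.
  move=> a0; have [|y yz] := app (a / 2); first by rewrite divr_gt0.
  have : glue z y < a / 2.
    by have := yz y; rewrite dxx subr0; apply: le_lt_trans; exact: ler_norm.
  move=> /glue_lt[q zq]; exists q => t.
  have fqy : d (f q) y < a / 2 by apply: le_lt_trans zq; rewrite lerDr.
  have := ler_distD (d y t) (glue z t) (d (f q) t).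
  have := d_lip y (f q) t; have := yz t; rewrite (d_sym y (f q)); lra.
apply: contrapT => /forallNP nz.
have far q : exists t, glue z t != d (f q) t.
  by apply: contrapT => /forallNP H; apply: (nz q); apply/funext => t;
     apply/eqP; apply: contrapT => /negP /H.
have cov : \forall a \near 0^'+, [set: X] `<=`
    (fun q => exists t, a < `|glue z t - d (f q) t|).
  have /compact_near_coveringP ncX := cX.
  apply: (ncX R 0^'+ (fun a q => exists t, a < `|glue z t - d (f q) t|)) => q _.
  have [t zt] := far q.
  pose b := `|glue z t - d (f q) t|.
  have b0 : 0 < b by rewrite normr_gt0 subr_eq0.
  have nq : \forall q' \near q, d (f q) (f q') < b / 2.
    have nb : nbhs (f q) [set y | d (f q) y < b / 2].
      by apply/nbhs_d; exists (b / 2) => //; rewrite divr_gt0.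
    have nq : nbhs q (f @^-1` [set y | d (f q) y < b / 2]) := cf nb.
    exact: nq.
  near=> q' a => /=; exists t.
  have ab : a < b / 2 by near: a; apply: nbhs_right_lt; rewrite divr_gt0.
  have qq : d (f q) (f q') < b / 2 by near: q'.
  have := ler_distD (d (f q') t) (glue z t) (d (f q) t).
  by have := d_lip (f q') (f q) t; rewrite (d_sym (f q') (f q)) -/b; lra.
have [a [za a0]] := filter_ex (filterI cov (nbhs_right_gt 0)).
have [q zq] := app' a a0; have [t] := za q I.
by rewrite ltNge zq.
Unshelve. all: by end_near. Qed.

Definition glue_set : set (arrow_uniform_type Y R) :=
  [set g | (exists y, g = d y) \/ exists z, g = glue z].

Lemma glue_space_metrizable : metrizable R glue_set.
Proof.
apply: (@pseudometric_metrizable R glue_set).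
apply: set_type_hausdorff => g g' gg'; apply/funext => t.
apply: (@Rhausdorff R) => A B /nbhs_ballP[a /= a0 aA] /nbhs_ballP[b /= b0 bB].
have [k [gk g'k]] := gg' _ _ (nbhsx_ballx g a a0) (nbhsx_ballx g' b b0).
by exists (k t); split; [apply: aA; exact: gk|apply: bB; exact: g'k].
Qed.

Let kappa_in y : glue_set (d y). Proof. by left; exists y. Qed.
Let glue_in z : glue_set (glue z). Proof. by right; exists z. Qed.

Definition kappa (y : Y) : glue_set :=
  exist (fun g : arrow_uniform_type Y R => g \in glue_set) _ (mem_set (kappa_in
    y)).

Definition glue_map (z : Z) : glue_set :=
  exist (fun g : arrow_uniform_type Y R => g \in glue_set) _ (mem_set (glue_in
    z)).

Let glue_ball (g g' : glue_set) (a : R) :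
  ball g a g' <-> forall t, `|set_val g t - set_val g' t| < a.
Proof. by []. Qed.

Lemma glue_map_e p : glue_map (e p) = kappa (f p).
Proof. by apply: set_val_inj; exact: glue_e. Qed.

Lemma glue_map_continuous : continuous glue_map.
Proof.
move=> z A /nbhs_ballP[a /= a0 aA].
have a20 : 0 < a / 2 by rewrite divr_gt0.
suff : nbhs z (glue_map @^-1` A) by [].
apply: filterS (glue_near z a20) => z' zz'; apply: aA; apply/glue_ball => t /=.
by apply: le_lt_trans (zz' t) _; lra.
Qed.

Lemma kappa_embedding : closed_embedding kappa.
Proof.
have kball y y' a : ball (kappa y) a (kappa y') -> d y y' < a.
  move=> /glue_ball /(_ y') yy'; have {yy'} : `|d y y' - d y' y'| < a := yy'.
  by rewrite dxx subr0; apply: le_lt_trans; exact: ler_norm.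
split.
- move=> y y' /(congr1 set_val) kyy'; apply: d_eq0.
  have -> : d y y' = d y' y' := congr1 (fun g : Y -> R => g y') kyy'.
  exact: dxx.
- move=> A; split=> [oA|[B oB <-]]; last first.
    apply: open_comp => // y _ C /nbhs_ballP[a /= a0 aC].
    suff : nbhs y (kappa @^-1` C) by [].
    apply/nbhs_d; exists a => // y' yy'; apply: aC; apply/glue_ball => t /=.
    exact: le_lt_trans (d_lip _ _ _) yy'.
  exists [set g : glue_set | exists2 a, 0 < a & forall y, ball g a (kappa y) ->
    A y].
    rewrite openE => g [a a0 gA] /=.
    apply/nbhs_ballP; exists (a / 2) => /=; first by rewrite divr_gt0.
    move=> g' gg'; exists (a / 2); first by rewrite divr_gt0.
    by move=> y g'y; apply: gA; rewrite [a]splitr; exact: ball_triangle gg' g'y.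
  rewrite eqEsubset; split=> y /=.
    by move=> [a a0]; apply; exact: ballxx.
  move=> Ay; have /nbhs_d[a a0 aA] : nbhs y A by apply: open_nbhs_nbhs.
  by exists a => // y' /kball; exact: aA.
- rewrite closure_id eqEsubset; split; first exact: subset_closure.
  move=> g clg; case: (set_val_in g) => [[y gy]|[z gz]].
    by exists y => //; apply: set_val_inj; rewrite gy.
  have [|q zq] := @glue_attained z; last first.
    by exists (f q) => //; apply: set_val_inj; rewrite gz zq.
  move=> a a0; have [_ [[y _ <-] gy]] := clg _ (nbhsx_ballx g a a0).
  by exists y => t; rewrite -gz; move/glue_ball : gy; exact.
Qed.

End metric_extensor.

Section ANR_extensor.
Context {R : realType}.

Lemma mdist_continuous (M : metricType R) :
  continuous (fun p : M * M => mdist p.1 p.2 : R).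
Proof.
move=> [x y]; apply/cvgrPdist_lt => a a0;
  exists (ball x (a / 2), ball y (a / 2)).
  by split; apply: nbhsx_ballx; rewrite divr_gt0.
move=> [x' y'] [/=]; rewrite !ballEmdist /= => xx' yy'.
rewrite ltr_norml; apply/andP; split.
  have := metric_triangle x' x y'; have := metric_triangle x y y'.
  by rewrite (metric_sym x' x); lra.
have := metric_triangle x x' y; have := metric_triangle x' y' y.
by rewrite (metric_sym y' y); lra.
Qed.

(** The neighborhood retraction is taken in the glued space, which
    is metrizable although Z need not be. *)
Lemma metrizable_ANR_extensor (X Y Z : topologicalType)
    (e : X -> Z) (f : X -> Y) (x0 : X) :
  ANR_in (@metrizable R) Y -> compactum X -> compactum Z ->
    closed_embedding e ->
  continuous f ->
  exists (W : set Z) (s : Z -> Y), [/\ open W, range e `<=` W,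
    forall w, W w -> {for w, continuous s} & forall x, s (e x) = f x].
Proof.
move=> [[M [h hh]] ext] hX hZ ee cf.
have ce := closed_embedding_continuous ee.
have ch : continuous h by case: hh => g [].
pose d (p : M * M) : R := mdist p.1 p.2.
have cd : continuous d by exact: mdist_continuous.
have [D [cD De]] : exists D : Z * Z -> R, continuous D /\
    forall p : X * X, D (e p.1, e p.2) = d (h (f p.1), h (f p.2)).
  have [cXX _] := prod_compactum hX hX; have [cZZ hZZ] := prod_compactum hZ hZ.
  apply: (@tietze_extension R (X * X)%type (Z * Z)%type (fun p => (e p.1, e
    p.2))) => //.
  - exact: compact_normal.
  - apply: compact_closed_embedding => //.
      by apply: continuous_pair;
        [exact: (continuous_compose (@continuous_fst X X) ce)|exact:
          (continuous_compose (@continuous_snd X X) ce)].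
    case: ee => ie _ _ [p q] [p' q'] /= [/ie -> /ie ->] //.
  - refine (continuous_compose (continuous_pair _ _) cd).
      exact: (continuous_compose (continuous_compose (@continuous_fst X X) cf)
        ch).
    exact: (continuous_compose (continuous_compose (@continuous_snd X X) cf)
      ch).
have De' p q : D (e p, e q) = mdist (h (f p)) (h (f q)) := De (p, q).
have [W0 nW0 [r cr rK]] := ext _ _ (@glue_space_metrizable R X Y Z M h e f D)
  (@kappa_embedding R X Y Z M h e f x0 D hX.1 hh cf).
apply: (@neighborhood_extension X Y Z _ e f _ (glue_map h e f D) W0 r (f x0))
  => //.
- exact: (glue_map_e x0 De').
- exact: (glue_map_continuous x0 hX.1 ce cD).
- exact: nW0.
- exact: rK.
Qed.

Lemma ANR_extensor (X Y Z : topologicalType) (e : X -> Z) (f : X ->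
  Y) (x0 : X) :
  ANR R Y -> compactum X -> compactum Z -> closed_embedding e ->
  continuous f ->
  exists (W : set Z) (s : Z -> Y), [/\ open W, range e `<=` W,
    forall w, W w -> {for w, continuous s} & forall x, s (e x) = f x].
Proof.
by case=> [hY|hY]; [exact: metrizable_ANR_extensor|exact: compact_ANR_extensor].
Qed.

Lemma ANR_normal (Y : topologicalType) : ANR R Y -> normal_space Y.
Proof.
case=> [[mY _]|[[cY hY] _]]; first exact: metrizable_normal mY.
exact: compact_normal.
Qed.

End ANR_extensor.

(** * An embedding-free form of the cell-like and UV properties *)

Definition contracts (R : realType) (tests : topologicalType -> Prop)
    (Y : topologicalType) (V U : set Y) : Prop :=
  forall S, tests S -> forall f : S -> Y, continuous f -> (forall s, V (f s)) ->
    null_homotopic_in R U f.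

Definition UV_near (R : realType) (tests : topologicalType -> Prop)
    (Y : topologicalType) (F : set Y) : Prop :=
  forall U : set Y, set_nbhs F U ->
    exists2 V : set Y, set_nbhs F V & contracts R tests V U.

(** The common form of cell-likeness (all spaces are tests) and UV^n (the
    tests are spheres), without reference to an ANR. *)
Definition UV_shape (R : realType) (tests : topologicalType -> Prop)
    (X : topologicalType) : Prop :=
  exists (T : choiceType) (e : X -> Rpow R T),
    [/\ continuous e, injective e, forall x, cube (e x)
      & UV_near R tests (range e)].

Section transfer.
Context {R : realType} (tests : topologicalType -> Prop).

Lemma null_homotopic_sub (S Y : topologicalType) (U U' : set Y) (f : S -> Y) :
  U `<=` U' -> null_homotopic_in R U f -> null_homotopic_in R U' f.
Proof. by move=> UU'; exact: (@null_homotopic_comp R S Y Y U U' f id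
  (@continuous_id Y)). Qed.

Lemma contracts_sub (Y : topologicalType) (V V' U U' : set Y) :
  V' `<=` V -> U `<=` U' -> contracts R tests V U -> contracts R tests V' U'.
Proof.
move=> VV UU VU S TS f cf fV; apply: (null_homotopic_sub UU).
by apply: VU => // s; exact/VV/fV.
Qed.

Lemma UV_near_open (Y : topologicalType) (F : set Y) :
  (forall U, open U -> F `<=` U ->
     exists2 V, set_nbhs F V & contracts R tests V U) -> UV_near R tests F.
Proof.
move=> H U /set_nbhsP[C [oC FC CU]]; have [V nV cV] := H C oC FC.
by exists V => //; exact: contracts_sub cV.
Qed.

Context {T : choiceType}.
Local Notation RT := (Rpow R T).

(** A map f into V is homotopic in U to beta o alpha o f along segments,
    and alpha o f contracts in U'. *)
Lemma contracts_transfer (Y : topologicalType) (V U : set RT) (V' U' : set Y)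
    (alpha : RT -> Y) (beta : Y -> RT) :
  (forall z, V z -> {for z, continuous alpha}) ->
  (forall z, V z -> V' (alpha z)) ->
  continuous beta -> (forall y, U' y -> U (beta y)) ->
  (forall z t, V z -> 0 <= t <= 1 -> U (line z (beta (alpha z)) t)) ->
  contracts R tests V' U' -> contracts R tests V U.
Proof.
move=> ca aV cb bU seg VU S TS f cf fV.
have caf : continuous (alpha \o f).
  by move=> s; apply: continuous_comp; [exact: cf|exact: ca].
apply: (@null_homotopic_line R T S U f (beta \o (alpha \o f))) => //.
- exact: (continuous_compose caf cb).
- by move=> s t t01; apply: seg.
- apply: (null_homotopic_comp cb bU); apply: VU => // s; exact: aV.
Qed.

Lemma segment_near (g : RT -> RT) (x : RT) (U : set RT) :
  open U -> {for x, continuous g} ->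
  (forall t, 0 <= t <= 1 -> U (line x (g x) t)) ->
  \forall z \near x, forall t, 0 <= t <= 1 -> U (line z (g z) t).
Proof.
move=> oU cg Ux.
have := @tube RT R RT `[0, 1]%classic (fun p => line p.1 (g p.1) p.2) U x
  (@segment_compact R 0 1) oU.
move=> H; have {}H := H _ _; apply: filterS (H _ _) => [z Hz t t01| |t].
- by apply: Hz; rewrite /= in_itv.
- move=> t _; apply: line_continuous;
  [exact: continuous_fst| |exact: continuous_snd].
  by apply: (@continuous_comp _ _ _ fst g); [exact: continuous_fst|exact: cg].
- by rewrite /= in_itv => t01; exact: Ux.
Qed.

(** The points to which [contracts_transfer] applies form a neighborhood
    of X, since the segments in question are compact. *)
Lemma UV_transfer (Y : topologicalType) (X W U : set RT) (V' U' : set Y)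
    (alpha : RT -> Y) (beta : Y -> RT) :
  open U -> open W -> X `<=` W ->
  (forall z, W z -> {for z, continuous alpha}) ->
  continuous beta -> (forall y, U' y -> U (beta y)) ->
  (forall x, X x -> nbhs (alpha x) V') ->
  (forall x t, X x -> 0 <= t <= 1 -> U (line x (beta (alpha x)) t)) ->
  contracts R tests V' U' ->
  exists2 V, set_nbhs X V & contracts R tests V U.
Proof.
move=> oU oW XW ca cb bU XV' seg VU.
exists [set z | [/\ W z, V' (alpha z) &
    forall t, 0 <= t <= 1 -> U (line z (beta (alpha z)) t)]].
  move=> x Xx.
  have nW : nbhs x W by apply: open_nbhs_nbhs; split=> //; exact: XW.
  have nV : nbhs x (alpha @^-1` V') := ca x (XW x Xx) _ (XV' x Xx).
  have cba : {for x, continuous (beta \o alpha)}.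
    by apply: continuous_comp; [exact: ca (XW _ Xx)|exact: cb].
  have nS := segment_near oU cba (fun t => seg x t Xx).
  by near=> z; split; near: z.
apply: contracts_transfer bU _ VU => //.
- by move=> z [Wz _ _]; exact: ca.
- by move=> z [].
- by move=> z t [_ _ h] /h.
Unshelve. all: by end_near. Qed.

End transfer.

Section cube_ANR.
Context {R : realType} {T : choiceType}.
Local Notation RT := (Rpow R T).

Lemma cube_ANR : ANR R (@cube R T).
Proof.
right; split; first exact: cube_compactum.
move=> Z e [cZ hZ] ee.
have [cC hC] := @cube_compactum R T.
have [g [cg ge]] := Rpow_extension cC (compact_normal hZ cZ) ee
  (@set_val_continuous RT cube).
exists setT; first by move=> x _; exact: filterT.
exists (fun w => to_cube (g (set_val w))).
  apply: (continuous_compose _ to_cube_continuous);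
    apply: (continuous_compose _ cg).
  exact: set_val_continuous.
move=> w y wy; apply: set_val_inj; rewrite wy ge to_cube_id//.
exact: set_val_in.
Qed.

Lemma to_cube_embedding (X : topologicalType) (e : X -> RT) :
  compactum X -> continuous e -> injective e -> (forall x, cube (e x)) ->
  closed_embedding (to_cube \o e).
Proof.
move=> [cX hX] ce ie eC; apply: compact_closed_embedding => //.
- by case: (@cube_compactum R T).
- exact: (continuous_compose ce to_cube_continuous).
- by move=> x y /(congr1 set_val); rewrite /= !to_cube_id// => /ie.
Qed.

(** The cube is a retract of R^T. *)
Lemma UV_near_cube (tests : topologicalType -> Prop) (X : topologicalType)
    (e : X -> RT) :
  (forall x, cube (e x)) ->
  UV_near R tests (range e) -> UV_near R tests (range (to_cube \o e)).
Proof.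
move=> eC nE U nU.
have [|V nV VU] := nE (to_cube @^-1` U).
  move=> _ [x _ <-]; apply: to_cube_continuous; apply: nU.
  by exists x.
exists (set_val @^-1` V).
  move=> _ [x _ <-]; apply: set_val_continuous; rewrite /= to_cube_id//.
  by apply: nV; exists x.
move=> S TS f cf fV.
have -> : f = to_cube \o (set_val \o f).
  apply/funext => s /=; apply: set_val_inj; rewrite to_cube_id//.
  exact: set_val_in.
apply: (null_homotopic_comp to_cube_continuous (U := to_cube @^-1` U)) => //.
apply: VU => //; exact: (continuous_compose cf (@set_val_continuous _ _)).
Qed.

End cube_ANR.

Section cell_like_shape.
Context {R : realType}.
Local Notation all_spaces := (fun _ : topologicalType => True).

Definition unit_itv (t : R) : `[0, 1]%classic :=
  exist (fun t => t \in `[0, 1]%classic) (clamp t)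
    (mem_set (clamp_itv t : `[0, 1]%classic (clamp t))).

Lemma unit_itv_continuous : continuous unit_itv.
Proof. by apply: continuous_set_type; exact: clamp_continuous. Qed.

Lemma unit_itv_id t : 0 <= t <= 1 -> set_val (unit_itv t) = t.
Proof. exact: clamp_id. Qed.

Lemma unit_itv_compactum : compactum `[0, (1 : R)]%classic.
Proof. exact: set_type_compactum (@segment_compact R 0 1) (@Rhausdorff R). Qed.

(** Homotopy extension: a contraction of X in U is extended to R^T,
    corrected by affine terms so as to start at the identity and end at a
    constant, and remains in U on a neighborhood of X. *)
Lemma contracts_near (T : choiceType) (X : topologicalType)
    (e : X -> Rpow R T) (U : set (Rpow R T)) :
  compactum X -> continuous e -> injective e -> (forall x, cube (e x)) ->
  open U -> contracts R all_spaces (range e) U ->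
  exists2 V, set_nbhs (range e) V & contracts R all_spaces V U.
Proof.
move=> hX ce ie eC oU /(_ X Logic.I e ce).
have /[swap]/[apply] : forall x, range e (e x) by move=> x; exists x.
move=> /null_homotopicP[H [c [cH UH H0 H1 Uc]]].
pose I := `[0, (1 : R)]%classic.
pose E (p : X * I) : @cube R T * I := (to_cube (e p.1), p.2).
have hXI := prod_compactum hX unit_itv_compactum.
have hCI := prod_compactum (@cube_compactum R T) unit_itv_compactum.
have cE : continuous E.
  apply: continuous_pair; last exact: continuous_snd.
  exact: (continuous_compose (continuous_compose (@continuous_fst X I) ce)
    to_cube_continuous).
have iE : injective E.
  move=> [x s] [y t] Est; have -> : s = t := congr1 snd Est.
  have /(congr1 set_val) : to_cube (e x) = to_cube (e y) := congr1 fst Est.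
  by rewrite !to_cube_id// => /ie ->.
pose Phi (p : X * I) : Rpow R T := H (p.1, set_val p.2).
have cPhi : continuous Phi.
  apply: (continuous_compose _ cH); apply: continuous_pair;
    first exact: continuous_fst.
  exact: (continuous_compose (@continuous_snd X I) (@set_val_continuous _ _)).
have [G [cG GE]] := Rpow_extension hXI.1 (compact_normal hCI.2 hCI.1)
  (compact_closed_embedding hXI.1 hCI.2 cE iE) cPhi.
pose HH (z : Rpow R T) (t : R) := G (to_cube z, unit_itv t).
have HHe x t : 0 <= t <= 1 -> HH (e x) t = H (x, t).
  move=> t01; have := GE (x, unit_itv t).
  by rewrite /E /Phi /= unit_itv_id.
(* The correction vanishes on X, where HH runs from e x to c. *)
pose K (p : Rpow R T * R) : Rpow R T := fun i => HH p.1 p.2 i +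
  ((1 - p.2) * (p.1 i - HH p.1 0 i) + p.2 * (c i - HH p.1 1 i)).
have cHH (S : topologicalType) (f : S -> Rpow R T) (h : S -> R) :
    continuous f -> continuous h -> continuous (fun s => HH (f s) (h s)).
  move=> cf ch; apply: (continuous_compose _ cG); apply: continuous_pair.
    exact: (continuous_compose cf to_cube_continuous).
  exact: (continuous_compose ch unit_itv_continuous).
have pr (S : topologicalType) (f : S -> Rpow R T) i : continuous f ->
    continuous (fun s => f s i : R).
  by move=> cf; exact: (continuous_compose cf (@Rpow_proj_continuous R T i)).
have cK : continuous K.
  apply: continuous_RpowP => i; apply: continuous_add.
    by apply: (pr _ (fun p => HH p.1 p.2)); apply: cHH;
      [exact: continuous_fst|exact: continuous_snd].
  apply: continuous_add; apply: continuous_mul.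
  - by apply: continuous_sub; [exact: continuous_cst|exact: continuous_snd].
  - apply: continuous_sub; first by apply: (pr _ fst); exact: continuous_fst.
    by apply: (pr _ (fun p => HH p.1 0)); apply: cHH;
      [exact: continuous_fst|exact: continuous_cst].
  - exact: continuous_snd.
  - apply: continuous_sub; first exact: continuous_cst.
    by apply: (pr _ (fun p => HH p.1 1)); apply: cHH;
      [exact: continuous_fst|exact: continuous_cst].
have Ke x t : 0 <= t <= 1 -> K (e x, t) = H (x, t).
  move=> t01; apply/funext => i; rewrite /K /= !HHe ?lexx ?ler01//.
  by rewrite (H0 x 0)// (H1 x 1)// !subrr !mulr0 !addr0.
have K0 z : K (z, 0) = z.
  by apply/funext => i; rewrite /K /= subr0 mul1r mul0r addr0 addrC subrK.
have K1 z : K (z, 1) = c.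
  by apply/funext => i; rewrite /K /= subrr mul1r mul0r add0r addrC subrK.
exists [set z | forall t, `[0, 1]%classic t -> U (K (z, t))].
  move=> _ [x _ <-].
  have UK t : `[0, 1]%classic t -> U (K (e x, t)).
    by rewrite /= in_itv => t01; rewrite Ke.
  exact: (@tube _ _ _ _ K U (e x) (@segment_compact R 0 1) oU
    (fun t _ => cK (e x, t)) UK).
move=> S _ f cf fV; exists (fun p => K (f p.1, p.2)), c; split=> //.
- apply: continuous_subspaceT; apply: (continuous_compose _ cK);
  apply: continuous_pair.
    exact: (continuous_compose (@continuous_fst S R) cf).
  exact: continuous_snd.
Qed.

(** X lies in Y and in R^T. The identity of X extends to a map from a
    neighborhood in R^T to Y because Y is an ANR, and to a map from Y to R^T by
    Tietze's theorem, so that the contractions in Y can be transferred. *)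
Lemma cell_like_shape (X : topologicalType) :
  compactum X -> cell_like_space R X -> UV_shape R all_spaces X.
Proof.
move=> hX [Y [e0 [hY ee0 [clY cell]]]].
have [[x0 _]|X0] := pselect ([set: X] !=set0); last first.
  have [|H [c [_ _ _ _ []]]] := cell set0.
  by move=> y [x _ _]; exfalso; apply: X0; exists x.
have ce : continuous (@unit_eval R X) := @unit_eval_continuous R X.
have ie : injective (@unit_eval R X) := unit_eval_injective hX.
have eC := @unit_eval_cube R X.
exists _, unit_eval; split=> //; apply: UV_near_open => U oU eU.
apply: contracts_near => //.
have ec := to_cube_embedding hX ce ie eC.
have [b [cb be]] := Rpow_extension hX.1 (ANR_normal hY) ee0 ce.
have [W [s [oW eW cs se]]] := ANR_extensor x0 hY hX cube_compactum ec
  (closed_embedding_continuous ee0).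
have re x : s (to_cube (unit_eval x)) = e0 x := se x.
have nU' : set_nbhs (range e0) (b @^-1` U).
  move=> _ [x _ <-]; apply: cb; apply: open_nbhs_nbhs; split=> //.
  by rewrite be; apply: eU; exists x.
have {nU'} ctr : contracts R all_spaces (range e0) (b @^-1` U).
  move=> S _ f cf fV; have null := cell _ nU'.
  have /choice[g gf] : forall s, exists w : range e0, set_val w = f s.
    by move=> s'; apply: set_type_ex; exact: fV.
  have -> : f = set_val \o g by apply/funext => s' /=; rewrite gf.
  apply: null_homotopic_precomp null; apply: continuous_set_type.
  by have -> : (fun s => set_val (g s)) = f by apply/funext.
apply: (contracts_transfer (alpha := s \o to_cube) _ _ cb _ _ ctr) => //.
- move=> _ [x _ <-]; apply: continuous_comp; first exact: to_cube_continuous.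
  by apply: cs; apply: eW; exists x.
- by move=> _ [x _ <-]; rewrite /= re; exists x.
- by move=> _ t [x _ <-] t01 /=; rewrite re be linexx; apply: eU; exists x.
Qed.

Lemma shape_cell_like (X : topologicalType) :
  compactum X -> UV_shape R all_spaces X -> cell_like_space R X.
Proof.
move=> hX [T [e [ce ie eC nE]]].
have ee := to_cube_embedding hX ce ie eC.
exists (@cube R T), (to_cube \o e); split=> //; first exact: cube_ANR.
split; first by case: ee.
move=> U /(UV_near_cube eC nE)[V nV VU]; apply: VU => //.
  exact: set_val_continuous.
by move=> s; apply: nbhs_singleton; apply: nV; exact: set_val_in.
Qed.

Definition sphere_upto (n : nat) (S : topologicalType) : Prop :=
  exists2 k, (k <= n)%N & S = sphere R k :> topologicalType.

Lemma sphere_nonempty k : exists x, sphere R k x.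
Proof.
exists (delta_mx 0 0); rewrite /sphere /= (bigD1 ord0) //=.
rewrite mxE !eqxx expr1n big1 ?addr0// => i /negPf i0.
by rewrite mxE i0 andbF expr0n.
Qed.

(** The argument of [cell_like_shape] with neighborhoods in place of X.
    If X is empty then so is V, and no sphere maps to it. *)
Lemma UV_space_shape (n : nat) (X : topologicalType) :
  compactum X -> UV_space R n X -> UV_shape R (sphere_upto n) X.
Proof.
move=> hX [Y [e0 [hY ee0 [clY cell]]]].
have ce : continuous (@unit_eval R X) := @unit_eval_continuous R X.
have ie : injective (@unit_eval R X) := unit_eval_injective hX.
have eC := @unit_eval_cube R X.
exists _, unit_eval; split=> //; apply: UV_near_open => U oU eU.
have [[x0 _]|X0] := pselect ([set: X] !=set0); last first.
  exists set0; first by move=> y [x _ _]; exfalso; apply: X0; exists x.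
  move=> S [k _ ->] f _ f0; have [z zk] := sphere_nonempty k.
  have [w _] := set_type_ex zk; by case: (f0 w).
have ec := to_cube_embedding hX ce ie eC.
have [b [cb be]] := Rpow_extension hX.1 (ANR_normal hY) ee0 ce.
have [W [s [oW eW cs se]]] := ANR_extensor x0 hY hX cube_compactum ec
  (closed_embedding_continuous ee0).
have re x : s (to_cube (unit_eval x)) = e0 x := se x.
have nU' : set_nbhs (range e0) (b @^-1` U).
  move=> _ [x _ <-]; apply: cb; apply: open_nbhs_nbhs; split=> //.
  by rewrite be; apply: eU; exists x.
have [V' [nV' _ ctr]] := cell _ nU'.
apply: (UV_transfer (W := to_cube @^-1` W) (alpha := s \o to_cube) (V' := V')
  (U' := b @^-1` U) oU _ _ _ cb) => //.
- by apply: open_comp => // z _; exact: to_cube_continuous.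
- by move=> _ [x _ <-]; apply: eW; exists x.
- move=> z Wz; apply: continuous_comp; first exact: to_cube_continuous.
  exact: cs.
- by move=> _ [x _ <-]; rewrite /= re; apply: nV'; exists x.
- by move=> _ t [x _ <-] t01 /=; rewrite re be linexx; apply: eU; exists x.
- by move=> S [k kn ->] f cf fV; apply: (ctr k) => // _ [x _ <-].
Qed.

Lemma shape_UV_space (n : nat) (X : topologicalType) :
  compactum X -> UV_shape R (sphere_upto n) X -> UV_space R n X.
Proof.
move=> hX [T [e [ce ie eC nE]]].
have ee := to_cube_embedding hX ce ie eC.
exists (@cube R T), (to_cube \o e); split=> //; first exact: cube_ANR.
split; first by case: ee.
move=> U nU; have [V nV VU] := UV_near_cube eC nE nU.
exists (V `&` U); split.
  by move=> y Fy; apply: filterI; [exact: nV|exact: nU].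
  by move=> z [].
move=> k kn f cf fV.
have Sk : sphere_upto n (sphere R k) by exists k.
by apply: (VU _ Sk f cf) => s; have [] :=
  fV (f s) (ex_intro2 _ _ s Logic.I erefl).
Qed.

End cell_like_shape.

(** * Limits of inverse systems *)

Section basic_neighborhoods.
Context {R : realType} {T : choiceType} {X : topologicalType}.
Local Notation RT := (Rpow R T).
Variable (e : X -> RT).

(** The union of the boxes of size a around the points of e(X), in the
    coordinates listed in F. These sets are given by finite data and form a
    base of neighborhoods of e(X) when X is compact. *)
Definition box_nbd (F : seq T) (a : R) : set RT :=
  [set z | exists x, forall t, t \in F -> `|z t - e x t| < a].

Lemma box_nbd_cylinder F a (z w : RT) : (forall t, t \in F -> z t = w t) ->
  box_nbd F a z -> box_nbd F a w.
Proof. by move=> zw [x xz]; exists x => t tF; rewrite -zw// xz. Qed.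

Lemma box_nbd_open F a : open (box_nbd F a).
Proof.
rewrite openE => z [x xz].
have : \forall w \near z, forall t, t \in F -> `|w t - e x t| < a.
  elim: F xz => [|t F IH] xz; first by near=> w.
  have nt : \forall w \near z, `|w t - e x t| < a.
    have zt : `|z t - e x t| < a by apply: xz; rewrite inE eqxx.
    have c : continuous (fun w : RT => `|w t - e x t|).
      apply: (fun H => continuous_compose H (@norm_continuous R R^o)).
      by apply: continuous_sub;
        [exact: Rpow_proj_continuous|exact: continuous_cst].
    have oN : nbhs `|z t - e x t| [set r | r < a].
      by apply: open_nbhs_nbhs; split=> //; exact: open_lt.
    exact: (c z _ oN).
  have xz' u : u \in F -> `|z u - e x u| < a by move=> uF;
    rewrite xz// inE uF orbT.
  have {IH xz'}nF := IH xz'.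
  by near=> w => u; rewrite inE => /orP[/eqP ->|]; [near: w|move: u; near: w].
by apply: filterS => w wx; exists x.
Unshelve. all: by end_near. Qed.

Lemma box_nbd_in F a x : 0 < a -> box_nbd F a (e x).
Proof. by move=> a0; exists x => t _; rewrite subrr normr0. Qed.

Lemma box_nbd_nbhs F a : 0 < a -> set_nbhs (range e) (box_nbd F a).
Proof.
move=> a0 _ [x _ <-]; apply: open_nbhs_nbhs; split; first exact: box_nbd_open.
exact: box_nbd_in.
Qed.

Hypotheses (cX : compact [set: X]) (ce : continuous e).

Lemma box_nbd_cofinal (U : set RT) : open U -> range e `<=` U ->
  exists F a, 0 < a /\ box_nbd F a `<=` U.
Proof.
move=> oU eU.
(* P holds for all large F and all small a. *)
pose G : set_system (seq T * R) := [set P | exists (F0 : seq T) (a0 : R),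
  0 < a0 /\ forall (F : seq T) (a : R), {subset F0 <= F} -> 0 < a <= a0 ->
    P (F, a)].
have FG : Filter G.
  split=> [|P Q [F [a [a0 FP]]] [F' [a' [a'0 FQ]]]|P Q PQ [F [a [a0 FP]]]].
  - by exists [::], 1.
  - exists (F ++ F'), (Num.min a a'); split; first by rewrite lt_min a0.
    move=> H b FH; rewrite le_min => /and3P[b0 ba ba'].
    split; [apply: FP|apply: FQ]; rewrite ?b0//.
      by move=> t tF; apply: FH; rewrite mem_cat tF.
    by move=> t tF; apply: FH; rewrite mem_cat tF orbT.
  - by exists F, a; split=> // H b FH ab; apply: PQ; exact: FP.
have : \forall i \near G, [set: X] `<=`
    (fun x => forall z, (forall t, t \in i.1 -> `|z t - e x t| < i.2) -> U z).
  have /compact_near_coveringP ncX := cX.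
  apply: (ncX _ G (fun (i : seq T * R) x => forall z : RT,
    (forall t, t \in i.1 -> `|z t - e x t| < i.2) -> U z)) => x _.
  have : nbhs (e x) U by apply: open_nbhs_nbhs; split=> //; apply: eU; exists x.
  move=> /nbhs_RpowP[F [a [a0 FU]]].
  exists ([set x' | forall t, t \in F -> `|e x' t - e x t| < a / 2],
    [set i | {subset F <= i.1} /\ 0 < i.2 <= a / 2]); first split.
  - have : nbhs (e x) [set w : RT | forall t, t \in F ->
    `|w t - e x t| < a / 2].
      by apply/nbhs_RpowP; exists F, (a / 2); split=> //; rewrite divr_gt0.
    exact: ce.
  - by exists F, (a / 2); split=> //; rewrite divr_gt0.
  move=> [x' [F' b]] /= [xx' [FF' /andP[b0 ba]]] z zx'.
  apply: FU => t tF; have := ler_distD (e x' t) (z t) (e x t).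
  by have := xx' t tF; have := zx' t (FF' t tF); lra.
move=> [F [a [a0 FU]]]; exists F, a; split=> // z [x xz].
by apply: (FU F a _ _ x) => //; rewrite a0 lexx.
Qed.

End basic_neighborhoods.
(** R^T need not be normal, so the extension is made on the cube and composed
  with the retraction. *)
Lemma cube_extension (R : realType) (T T' : choiceType) (X : topologicalType)
    (e : X -> Rpow R T) (phi : X -> Rpow R T') :
  compactum X -> continuous e -> injective e -> (forall x, cube (e x)) ->
  continuous phi ->
  exists g : Rpow R T -> Rpow R T', continuous g /\ forall x, g (e x) = phi x.
Proof.
move=> hX ce ie eC cphi.
have [cC hC] := @cube_compactum R T.
have [g [cg ge]] := Rpow_extension hX.1 (compact_normal hC cC)
  (to_cube_embedding hX ce ie eC) cphi.
by exists (g \o to_cube); split;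
  [exact: continuous_compose to_cube_continuous cg|].
Qed.

Section large_bonds.
Context {d : Order.disp_t} {A : porderType d} (S : inverse_system A).

Lemma lt_of_le_neq (a b : A) : (a <= b)%O -> a <> b -> (a < b)%O.
Proof. by move=> ab /eqP nab; rewrite lt_neqAle nab. Qed.

(** Bonds for non-strict inequalities, so that an index that bounds
    finitely many others may be one of them. *)
Definition bond_le (a b : A) (ab : (a <= b)%O) : S b -> S a :=
  match pselect (a = b) with
  | left e => fun s => eq_rect b (fun c => S c : Type) s a (esym e)
  | right n => bond (lt_of_le_neq ab n)
  end.

Lemma bond_le_id (a : A) (aa : (a <= a)%O) s : bond_le aa s = s.
Proof.
rewrite /bond_le; case: pselect => [e|[]//].
by rewrite (Prop_irrelevance (esym e) erefl).
Qed.

Lemma bond_le_lt (a b : A) (ab : (a <= b)%O) (ab' : (a < b)%O) s :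
  bond_le ab s = bond ab' s.
Proof.
rewrite /bond_le; case: pselect => [e|n]; last first.
  by congr (bond _ _); exact: Prop_irrelevance.
by exfalso; move: ab'; rewrite e ltxx.
Qed.

Lemma bond_le_trans (a b c : A) (ab : (a <= b)%O) (bc : (b <= c)%O)
  (ac : (a <= c)%O) s : bond_le ac s = bond_le ab (bond_le bc s).
Proof.
have /orP[/eqP eab|lab] : (a == b) || (a < b)%O by rewrite -le_eqVlt.
  by subst b; rewrite bond_le_id; congr (bond_le _ _); exact: Prop_irrelevance.
have /orP[/eqP ebc|lbc] : (b == c) || (b < c)%O by rewrite -le_eqVlt.
  by subst c; rewrite (bond_le_id bc); congr (bond_le _ _);
    exact: Prop_irrelevance.
have lac := lt_trans lab lbc.
by rewrite (bond_le_lt _ lac) (bond_le_lt _ lab) (bond_le_lt _ lbc);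
  exact: bond_comp.
Qed.

Lemma bond_le_continuous (a b : A) (ab : (a <= b)%O) : continuous (bond_le ab).
Proof.
have /orP[/eqP e|l] : (a == b) || (a < b)%O by rewrite -le_eqVlt.
  subst b; have -> : bond_le ab = id by apply/funext => s; exact: bond_le_id.
  exact: continuous_id.
have -> : bond_le ab = bond l by apply/funext => s; exact: bond_le_lt.
exact: bond_continuous.
Qed.

Lemma bond_le_thread (x : prod_topology (stage S)) (a b : A) (ab : (a <= b)%O) :
  inverse_limit S x -> bond_le ab (x b) = x a.
Proof.
move=> xS; have /orP[/eqP e|l] : (a == b) || (a < b)%O by rewrite -le_eqVlt.
  by subst b; exact: bond_le_id.
by rewrite (bond_le_lt _ l); exact: xS.
Qed.

Lemma directed_bound (T : eqType) (F : seq T) (f : T -> A) : directed A ->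
  exists a, forall t, t \in F -> (f t <= a)%O.
Proof.
move=> [[a0 _] dA]; elim: F => [|t F [a aF]]; first by exists a0.
have [b ab tb] := dA a (f t); exists b => u; rewrite inE => /orP[/eqP -> //|uF].
exact: le_trans (aF u uF) ab.
Qed.

End large_bonds.

Section limit_shape.
Context {R : realType} (tests : topologicalType -> Prop).
Context {d : Order.disp_t} {A : porderType d} (S : inverse_system A).
Hypotheses (dA : directed A) (cS : forall a, compactum (S a)).

(** Otherwise, for b >= a0, the points of S b outside C b give a directed
    family of nonempty closed sets in the compact product of the stages. A
    point common to them is a thread that never enters C. *)
Lemma limit_escape (a0 : A) (C : forall b, set (S b)) :
  (forall b, (a0 <= b)%O -> open (C b)) ->
  (forall b c (bc : (b <= c)%O) s, (a0 <= b)%O -> C b (bond_le bc s) ->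
    C c s) ->
  (forall x, inverse_limit S x -> exists2 b, (a0 <= b)%O & C b (x b)) ->
  exists2 b, (a0 <= b)%O & forall s, C b s.
Proof.
move=> oC Cbond limC; apply: contrapT => noesc.
have bad b : (a0 <= b)%O -> exists s, ~ C b s.
  move=> ab; apply: contrapT => /forallNP nC; apply: noesc; exists b => // s.
  by apply: contrapT; exact: nC.
(* Families that are coherent up to b and avoid C b. *)
pose D b : set (prod_topology (stage S)) := [set x |
  (forall b' (h : (b' <= b)%O), bond_le h (x b) = x b') /\ ~ C b (x b)].
have D0 b : (a0 <= b)%O -> D b !=set0.
  move=> ab; have [s ns] := bad b ab.
  have pt b' : exists z : S b', forall h : (b' <= b)%O, bond_le h s = z.
    have [h|h] := pselect (b' <= b)%O.
      by exists (bond_le h s) => h'; congr (bond_le _ _);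
        exact: Prop_irrelevance.
    have [_ dir] := dA; have [c b'c a0c] := dir b' a0.
    by have [z _] := bad c a0c; exists (bond_le b'c z) => h'; case: (h h').
  pose x b' := sval (cid (pt b')).
  have xP b' : forall h : (b' <= b)%O, bond_le h s = x b' :=
    svalP (cid (pt b')).
  exists x; split=> [b' h|].
    by rewrite -(xP b' h) -(xP b (lexx b)) bond_le_id.
  by rewrite -(xP b (lexx b)) bond_le_id.
have Dle b c : (a0 <= b)%O -> (b <= c)%O -> D c `<=` D b.
  move=> ab bc x [xc nc]; split=> [b' h|].
    by rewrite -(xc b bc) -(bond_le_trans h bc (le_trans h bc)) xc.
  by rewrite -(xc b bc) => /(Cbond b c bc _ ab).
pose G := filter_from [set b | (a0 <= b)%O] D.
have PG : ProperFilter G.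
  apply: filter_from_proper => [|b /D0//].
  apply: filter_from_filter; first by exists a0 => /=.
  move=> b c /= ab ac; have [_ dir] := dA; have [k bk ck] := dir b c.
  exists k => /=; first exact: le_trans ab bk.
  by move=> x Dx; split; [exact: Dle Dx|exact: Dle Dx].
have cP : compact [set: prod_topology (stage S)].
  have := @tychonoff A (stage S) (fun _ => setT) (fun a => (cS a).1).
  by congr (compact _); rewrite eqEsubset; split.
have [x [_ clx]] := cP G PG filterT.
have prc (a : A) : continuous (fun z : prod_topology (stage S) => z a).
  exact: (@proj_continuous A (stage S) a).
have Dx b : (a0 <= b)%O -> D b x.
  move=> ab.
  have clD (N : set (prod_topology (stage S))) : nbhs x N -> (D b `&` N) !=set0.
    by move=> nN; apply: clx => //; exists b.
  split=> [b' h|Cb].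
    apply: (cS b').2 => P Q nP nQ.
    have nP' : nbhs x (fun z : prod_topology (stage S) => P (bond_le h (z b)))
      :=
      continuous_compose (prc b) (@bond_le_continuous d A S b' b h) nP.
    have nQ' : nbhs x (fun z : prod_topology (stage S) => Q (z b')) :=
      prc b' x _ nQ.
    have [z [[zb _] [Pz Qz]]] := clD _ (filterI nP' nQ').
    by exists (z b'); split=> //; rewrite -(zb b' h).
  have nC : nbhs x (fun z : prod_topology (stage S) => C b (z b)).
    by apply: prc; apply: open_nbhs_nbhs; split=> //; exact: oC.
  by have [z [[_ nCz] Cz]] := clD _ nC.
have xS : inverse_limit S x.
  move=> a b ab; have [_ dir] := dA; have [c bc ac] := dir b a0.
  have [xc _] := Dx c ac.
  rewrite -(xc b bc) -(xc a (le_trans (ltW ab) bc)) -(bond_le_lt (ltW ab)).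
  by rewrite -(bond_le_trans _ _ (le_trans (ltW ab) bc)).
by have [b ab Cb] := limC x xS; have [_] := Dx b ab; apply.
Qed.

(** X is embedded by the unit functions of all stages, composed with the
    projections. A neighborhood of X involves finitely many of them, hence one
    stage; far enough out the stage itself is mapped into the neighborhood, and
    [UV_transfer] applies. *)
Lemma limit_UV_shape (X : topologicalType) (h : X -> inverse_limit S) :
  compactum X -> homeomorphism h -> (forall a, UV_shape R tests (S a)) ->
  UV_shape R tests X.
Proof.
move=> hX [g [hK gK ch cg]] shS.
pose T : choiceType := {classic {a : A & @unit_fun R (S a)}}.
pose p a x : S a := set_val (h x) a.
have cp a : continuous (p a).
  exact: (continuous_compose (continuous_compose ch (@set_val_continuous _ _))
    (@proj_continuous A (stage S) a)).
have pS x : inverse_limit S (set_val (h x)) by exact: set_val_in.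
pose tagT (t : T) : A := projT1 (t : {a : A & @unit_fun R (S a)}).
pose funT (t : T) : S (tagT t) -> R :=
  sval (projT2 (t : {a : A & @unit_fun R (S a)})).
have cfun t : continuous (funT t) by case: t => a [f []].
have fun01 t s : 0 <= funT t s <= 1 by case: t s => a [f []].
pose e (x : X) : Rpow R T := fun t => funT t (p (tagT t) x).
have ce : continuous e.
  by apply: continuous_RpowP => t; exact: (continuous_compose (cp _) (cfun t)).
have ie : injective e.
  move=> x y exy; apply: (can_inj hK); apply: set_val_inj.
  apply: functional_extensionality_dep => a; apply: contrapT.
  move=> /(unit_fun_separates (R := R) (cS a))[f [f0 f1]].
  pose t : T := existT (fun a => @unit_fun R (S a)) a f.
  have := congr1 (fun z : Rpow R T => z t) exy.
  rewrite /e /funT /p /=; rewrite f0 f1 => /esym/eqP; by rewrite oner_eq0.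
have eC x : cube (e x) by move=> t; exact: fun01.
exists T, e; split=> //; apply: UV_near_open => U oU eU.
have [F [a [a0 FU]]] := box_nbd_cofinal hX.1 ce oU eU.
have [c0 Fc0] := directed_bound F tagT dA.
(* The embedding e read on the stage c, as far as the coordinates come from
   stages below c. *)
pose b c (s : S c) : Rpow R T := fun t =>
  if pselect (tagT t <= c)%O is left tc then funT t (bond_le tc s) else 0.
have bE c t (tc : (tagT t <= c)%O) s : b c s t = funT t (bond_le tc s).
  rewrite /b; case: pselect => [tc'|[]//].
  by congr (funT t (bond_le _ _)); exact: Prop_irrelevance.
have cb c : continuous (b c).
  apply: continuous_RpowP => t.
  have [tc|ntc] := pselect (tagT t <= c)%O.
    have -> : (fun s => b c s t) = (fun s => funT t (bond_le tc s)).
      by apply/funext => s; exact: bE.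
    exact: (continuous_compose (@bond_le_continuous _ _ S _ _ tc) (cfun t)).
  have -> : (fun s => b c s t) = fun=> 0.
    by apply/funext => s; rewrite /b; case: pselect.
  exact: continuous_cst.
have bp c x t : t \in F -> (c0 <= c)%O -> b c (p c x) t = e x t.
  move=> tF cc; have tc : (tagT t <= c)%O := le_trans (Fc0 t tF) cc.
  by rewrite (bE _ _ tc) /p (bond_le_thread _ (pS x)).
have [||| c cc allc] := @limit_escape c0 (fun c s => box_nbd e F a (b c s)).
- move=> c cc; apply: open_comp; last exact: box_nbd_open.
  by move=> s _; exact: cb.
- move=> c c' cc' s c0c; apply: box_nbd_cylinder => t tF.
  have tc : (tagT t <= c)%O := le_trans (Fc0 t tF) c0c.
  by rewrite (bE _ _ tc) (bE _ _ (le_trans tc cc')) -(bond_le_trans tc cc'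
    (le_trans tc cc')).
- move=> x xS; exists c0 => //.
  have [w wx] := set_type_ex xS.
  exists (g w) => t tF; rewrite -(bp c0)//.
  by rewrite /p gK wx subrr normr0.
have [T' [e' [ce' ie' eC' nE']]] := shS c.
have [al [cal ale]] := cube_extension hX ce ie eC (continuous_compose (cp c)
  ce').
have [be [cbe bee]] := cube_extension (cS c) ce' ie' eC' (cb c).
have [|V' nV' V'U'] := nE' (be @^-1` U).
  move=> _ [s _ <-]; apply: cbe; apply: open_nbhs_nbhs; split=> //.
  by rewrite bee; apply: FU; exact: allc.
apply: (UV_transfer (W := setT) (alpha := al) (beta := be) (V' := V')
  (U' := be @^-1` U) oU openT) => //.
- by move=> z _; exact: cal.
- by move=> _ [x _ <-]; rewrite ale; apply: nV'; exists (p c x).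
- move=> _ r [x _ <-] r01; rewrite ale bee; apply: FU; exists x => t tF.
  by rewrite /line bp// -mulrDl subrK mul1r subrr normr0.
Qed.

End limit_shape.

(** * Countable coordinate sets and the shadows of a compactum *)

Section countable_closure.
Context {T : choiceType} (op : seq T -> nat -> seq T).

Definition op_closed (B : set T) : Prop :=
  forall F k, (forall t, t \in F -> B t) -> forall t, t \in op F k -> B t.

(** A finite sequence is coded by the sequence of the codes of its
    entries. *)
Lemma countable_seqs (B : set T) : countable B ->
  countable [set F : seq T | forall t, t \in F -> B t].
Proof.
move=> /countable_injP[f finj]; apply/countable_injP.
exists (fun F => pickle [seq f t | t <- F]) => F F'.
rewrite !inE /= => FB F'B /(pcan_inj pickleK).
elim: F F' FB F'B => [[]//|t F IH [|t' F']//= FB F'B [ft FF']].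
congr (_ :: _); last first.
  by apply: IH => // u uF; [apply: FB|apply: F'B]; rewrite inE uF orbT.
by apply: finj => //; rewrite inE; [apply: FB|apply: F'B]; rewrite inE eqxx.
Qed.

Lemma chain_seq (B : nat -> set T) (F : seq T) :
  (forall k, B k `<=` B k.+1) -> (forall t, t \in F -> (\bigcup_k B k) t) ->
  exists k, forall t, t \in F -> B k t.
Proof.
move=> Bm.
have Ble j k : (j <= k)%N -> B j `<=` B k.
  move=> /subnK <-; elim: (k - j)%N => [//|i IH]; apply: subset_trans IH _.
  by rewrite addSn.
elim: F => [|t F IH] FB; first by exists 0%N.
have [k Fk] : exists k, forall u, u \in F -> B k u.
  by apply: IH => u uF; apply: FB; rewrite inE uF orbT.
have [j _ tj] := FB t (mem_head _ _).
exists (maxn j k) => u; rewrite inE => /orP[/eqP ->|uF].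
  exact: Ble (leq_maxl _ _) _ tj.
by apply: Ble (leq_maxr _ _) _ _; exact: Fk.
Qed.

Lemma op_closed_bigcup (B : nat -> set T) :
  (forall k, B k `<=` B k.+1) -> (forall k, op_closed (B k)) ->
  op_closed (\bigcup_k B k).
Proof.
move=> Bm Bc F k /(chain_seq Bm)[j Fj] t tF; exists j => //.
exact: Bc Fj _ tF.
Qed.

(** All values of op on sequences over the set are added, and this is
    iterated countably often. *)
Lemma countable_closure (C : set T) : countable C ->
  exists B, [/\ countable B, op_closed B & C `<=` B].
Proof.
move=> cC.
pose step (D : set T) := D `|` \bigcup_(F in [set F | forall t, t \in F -> D t])
  \bigcup_k [set t | t \in op F k].
pose D := fix D k := if k is k'.+1 then step (D k') else C.
have cD k : countable (D k).
  elim: k => [//|k IH] /=; rewrite /step.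
  have U : countable (\bigcup_b (if b then D k else
      \bigcup_(F in [set F | forall t, t \in F -> D k t])
        \bigcup_j [set t | t \in op F j])).
    apply: bigcup_countable => // -[] _ //.
    apply: bigcup_countable; first exact: countable_seqs.
    move=> F _; apply: bigcup_countable => // j _.
    apply: finite_set_countable; exact: finite_seq.
  apply: sub_countable U; apply: subset_card_le => t [Dt|Ft].
    by exists true.
  by exists false.
have Dm k : D k `<=` D k.+1 by move=> t Dt; left.
exists (\bigcup_k D k); split.
- by apply: bigcup_countable.
- move=> F k /(chain_seq Dm)[j Fj] t tF; exists j.+1 => //; right.
  by exists F => //; exists k.
- by move=> t Ct; exists 0%N.
Qed.

End countable_closure.

Section restriction.
Context {R : realType} {T : choiceType}.
Local Notation RT := (Rpow R T).

(** The projection to the coordinates in B. The other coordinates are set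
    to 0 instead of being dropped, so that all shadows lie in the same space. *)
Definition restr (B : set T) (z : RT) : RT :=
  fun t => if `[< B t >] then z t else 0.

Lemma restr_in (B : set T) z t : B t -> restr B z t = z t.
Proof. by move=> Bt; rewrite /restr asboolT. Qed.

Lemma restr_out (B : set T) z t : ~ B t -> restr B z t = 0.
Proof. by move=> Bt; rewrite /restr asboolF. Qed.

Lemma restr_sub (B C : set T) z : B `<=` C -> restr B (restr C z) = restr B z.
Proof.
move=> BC; apply/funext => t; have [Bt|nBt] := pselect (B t).
  by rewrite !restr_in//; exact: BC.
by rewrite !restr_out.
Qed.

Lemma restr_continuous (B : set T) : continuous (restr B).
Proof.
apply: continuous_RpowP => t; have [Bt|nBt] := pselect (B t).
  have -> : (fun s => restr B s t) = (fun s => s t).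
    by apply/funext => s; exact: restr_in.
  exact: Rpow_proj_continuous.
have -> : (fun s => restr B s t) = (fun=> 0).
  by apply/funext => s; exact: restr_out.
exact: continuous_cst.
Qed.

Lemma restr_cube (B : set T) z : cube z -> cube (restr B z).
Proof. by move=> cz t; rewrite /restr; case: ifP => // _;
  rewrite lexx ler01. Qed.

Context {X : topologicalType} (e : X -> RT).
Hypotheses (cX : compact [set: X]) (ce : continuous e).

Definition shadow (B : set T) : set RT := range (fun x => restr B (e x)).

Lemma shadow_compact (B : set T) : compact (shadow B).
Proof.
apply: continuous_compact => //; apply: continuous_subspaceT.
exact: (continuous_compose ce (@restr_continuous B)).
Qed.

Lemma shadow_restr (B : set T) z : shadow B z -> restr B z = z.
Proof. by move=> [x _ <-]; rewrite restr_sub. Qed.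

(** The z i prescribe the coordinates in the union of the B i. The point
    with these coordinates belongs to the closure of the shadow over the union,
    because finitely many coordinates are always realized by one z i; and the
    shadow is compact. *)
Lemma shadow_glue (I : Type) (B : I -> set T) (z : I -> RT) :
  (forall F : seq T, (forall t, t \in F -> exists i, B i t) ->
     exists i, forall t, t \in F -> B i t) ->
  (forall i, shadow (B i) (z i)) ->
  (forall i j t, B i t -> B j t -> z i t = z j t) ->
  exists x, forall i, restr (B i) (e x) = z i.
Proof.
move=> dB Bz zz.
(* The point w has the coordinates prescribed by the z i, arbitrary ones outside
   BB. *)
pose BB : set T := [set t | exists i, B i t].
have ex_w : forall t, exists r, forall i, B i t -> z i t = r.
  move=> t; have [[i Bi]|nB] := pselect (BB t).
    by exists (z i t) => j Bj; exact: zz.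
  by exists 0 => i Bi; case: nB; exists i.
have [w wP] := choice ex_w.
have : shadow BB (restr BB w).
  have : closed (shadow BB).
    by apply: compact_closed; [exact: Rpow_hausdorff|exact: shadow_compact].
  rewrite closure_id => ->; move=> N /nbhs_RpowP[F [a [a0 FN]]].
  have [t|i FB] := dB [seq t <- F | `[< BB t >]].
    by rewrite mem_filter => /andP[/asboolP].
  have [x _ xz] := Bz i.
  exists (restr BB (e x)); split; first by exists x.
  apply: FN => t tF; have [Bt|nBt] := pselect (BB t).
    have Bit : B i t by apply: FB; rewrite mem_filter asboolT.
    by rewrite !restr_in// -(wP t i Bit) -xz restr_in// subrr normr0.
  by rewrite !restr_out// subrr normr0.
move=> [x _ xw]; exists x => i.
have iBB : B i `<=` BB by move=> t Bt; exists i.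
rewrite -(restr_sub _ iBB) xw (restr_sub _ iBB) -(shadow_restr (Bz i)).
apply/funext => t; have [Bt|nBt] := pselect (B i t).
  by rewrite !restr_in// (wP t i Bt).
by rewrite !restr_out.
Qed.

(** A point of the shadow is determined by its countably many coordinates
    in B, so that the shadow embeds in a countable power of the line. *)
Lemma shadow_metrizable (B : set T) : countable B -> metrizable R (shadow B).
Proof.
move=> /countable_injP[f finj].
pose N : pseudoMetricType R := prod_topology (fun _ : nat => R :
  pseudoMetricType R).
pose v (z : shadow B) : N := fun n =>
  if pselect (exists t, B t /\ f t = n) is left h
  then set_val z (sval (cid h)) else 0.
have cv : continuous v.
  apply: (@continuous_RpowP R nat) => n; rewrite /v.
  case: pselect => h; last exact: continuous_cst.
  exact: (continuous_compose (@set_val_continuous _ _) (@Rpow_proj_continuous R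
    T _)).
have iv : injective v.
  move=> z z' vz; apply: set_val_inj.
  rewrite -(shadow_restr (set_val_in z)) -(shadow_restr (set_val_in z')).
  apply/funext => t; have [Bt|nBt] := pselect (B t); last by rewrite !restr_out.
  rewrite !restr_in//; have := congr1 (fun g : N => g (f t)) vz; rewrite /v.
  case: pselect => [h|[]]; last by exists t.
  have [Bs fs] := svalP (cid h).
  by rewrite (finj _ _ _ _ fs) ?inE.
have hN : hausdorff_space N := @Rpow_hausdorff R nat.
pose v' (z : shadow B) : range v :=
  exist (fun g : N => g \in range v) (v z) (mem_set (ex_intro2 _ _ z Logic.I
    erefl)).
apply: (@metrizable_homeomorphic R _ (range v) v').
  apply: compact_homeomorphism.
  - by apply: set_type_compact; exact: shadow_compact.
  - exact: set_type_hausdorff.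
  - exact: continuous_set_type.
  - by move=> z z' /(congr1 set_val) /iv.
  - move=> g; have [z _ zg] := set_val_in g; exists z; exact: set_val_inj.
exact: (@pseudometric_metrizable R (range v) (@set_type_hausdorff N (range v)
  hN)).
Qed.

End restriction.

(** * The spectrum of shadows *)

Section index_set.
Context {T : choiceType} (op : seq T -> nat -> seq T).

Definition admissible (B : set T) : Prop := countable B /\ op_closed op B.

Definition coord_index : Type := {B : set T | `[< admissible B >]}.
HB.instance Definition _ := SubChoice.on coord_index.
HB.instance Definition _ :=
  [SubChoice_isSubPOrder of coord_index by <: with set_display].

Implicit Types a b : coord_index.

Lemma coord_indexP a : admissible (val a).
Proof. exact/asboolP/(valP a). Qed.

Lemma coord_index_le a b : (a <= b)%O <-> val a `<=` val b.
Proof. by split=> [/(@subsetPset T)|/(@subsetPset T)]. Qed.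

Lemma coord_index_lt a b : (a < b)%O -> val a `<=` val b.
Proof. by move=> /ltW /coord_index_le. Qed.

Lemma coord_index_ex (B : set T) : admissible B -> exists a, val a = B.
Proof. by move=> /asboolP aB; exists (exist _ B aB). Qed.

(** The union of two countable sets lies in a countable closed set. *)
Lemma coord_index_directed : directed coord_index.
Proof.
have ex (C : set T) : countable C -> exists a, C `<=` val a.
  move=> /(countable_closure op)[B [cB oB CB]].
  by have [a aB] := coord_index_ex (conj cB oB); exists a; rewrite aB.
split; first by have [a _] := ex set0 (countable0 _); exists a.
move=> a b; have [|c abc] := ex (val a `|` val b).
  have -> : val a `|` val b = \bigcup_(i in [set: bool]) (if i then val a else
    val b).
    rewrite eqEsubset; split=> [t [at_|bt]|t [[] _ tt]].
    - by exists true.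
    - by exists false.
    - by left.
    - by right.
  by apply: bigcup_countable => // -[] _;
    [case: (coord_indexP a)|case: (coord_indexP b)].
by exists c; apply/coord_index_le => t tt; apply: abc; [left|right].
Qed.

Lemma coord_index_cover (F : seq T) :
  exists a : coord_index, forall t, t \in F -> val a t.
Proof.
have cF : countable [set` F] by apply: finite_set_countable; exact: finite_seq.
have [B [cB oB FB]] := countable_closure op cF.
by have [a aB] := coord_index_ex (conj cB oB); exists a => t tF; rewrite aB;
  exact: FB.
Qed.

End index_set.

Section spectrum.
Context {R : realType} {T : choiceType} {X : topologicalType}.
Local Notation RT := (Rpow R T).
Variables (e : X -> RT) (op : seq T -> nat -> seq T).
Hypotheses (hX : compactum X) (ce : continuous e).

Lemma shadow_bond (a b : coord_index op) (ab : (a < b)%O) (z : shadow e (val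
  b)) :
  shadow e (val a) (restr (val a) (set_val z)).
Proof.
have [x _ <-] := set_val_in z; exists x => //.
by rewrite restr_sub//; exact: coord_index_lt.
Qed.

Definition spectrum_bond (a b : coord_index op) (ab : (a < b)%O)
    (z : shadow e (val b)) : shadow e (val a) :=
  exist (fun w : RT => w \in shadow e (val a)) _ (mem_set (shadow_bond ab z)).

Lemma spectrum_bondE (a b : coord_index op) (ab : (a < b)%O) (z : shadow e (val
  b)) :
  set_val (spectrum_bond ab z) = restr (val a) (set_val z).
Proof. by []. Qed.

Lemma spectrum_bond_continuous (a b : coord_index op) (ab : (a < b)%O) :
  continuous (spectrum_bond ab).
Proof.
apply: continuous_set_type.
exact: (continuous_compose (@set_val_continuous _ _) (@restr_continuous R T
  (val a))).
Qed.

Lemma spectrum_bond_comp (a b c : coord_index op) (ab : (a < b)%O) (bc : (b <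
  c)%O)
    (ac : (a < c)%O) (z : shadow e (val c)) :
  spectrum_bond ac z = spectrum_bond ab (spectrum_bond bc z).
Proof. by apply: set_val_inj; rewrite !spectrum_bondE restr_sub//;
  exact: coord_index_lt. Qed.

Definition spectrum : inverse_system (coord_index op) :=
  @InverseSystem _ (coord_index op) (fun a => shadow e (val a) :
    topologicalType)
    spectrum_bond spectrum_bond_continuous spectrum_bond_comp.

Lemma shadow_in (B : set T) x : shadow e B (restr B (e x)).
Proof. by exists x. Qed.

Definition to_shadow (B : set T) (x : X) : shadow e B :=
  exist (fun w : RT => w \in shadow e B) _ (mem_set (shadow_in B x)).

Lemma to_shadowE B x : set_val (to_shadow B x) = restr B (e x).
Proof. by []. Qed.

Lemma to_shadow_continuous B : continuous (to_shadow B).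
Proof. by apply: continuous_set_type;
  exact: (continuous_compose ce (@restr_continuous R T B)). Qed.

Lemma shadow_compactum (B : set T) : compactum (shadow e B).
Proof. by apply: set_type_compactum;
  [exact: shadow_compact hX.1 ce B|exact: Rpow_hausdorff]. Qed.

Lemma spectrum_limit : injective e ->
  exists h : X -> inverse_limit spectrum, homeomorphism h.
Proof.
move=> ie.
have lim x : inverse_limit spectrum (fun a => to_shadow (val a) x).
  move=> a b ab; apply: set_val_inj.
  by rewrite spectrum_bondE !to_shadowE restr_sub//; exact: coord_index_lt.
pose h x : inverse_limit spectrum :=
  exist (fun z : prod_topology (stage spectrum) => z \in inverse_limit
    spectrum) _ (mem_set (lim x)).
exists h; apply: compact_homeomorphism.
- exact: hX.1.
- apply: set_type_hausdorff; apply: hausdorff_product => a.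
  by case: (shadow_compactum (val a)).
- apply: continuous_set_type; apply: continuous_prod => a.
  exact: to_shadow_continuous.
- move=> x y /(congr1 set_val) hxy; apply: ie; apply/funext => t.
  have [a at_] := coord_index_cover op [:: t].
  have {at_} at' : val a t by apply: at_; rewrite inE.
  have : restr (val a) (e x) t = restr (val a) (e y) t :=
    congr1 (fun z : prod_topology (stage spectrum) => set_val (z a) t) hxy.
  by rewrite !restr_in.
move=> y; have yl := set_val_in y; pose z a : RT := set_val (set_val y a).
have zz a b : (a <= b)%O -> restr (val a) (z b) = z a.
  move=> ab; have /orP[/eqP <-|lab] : (a == b) || (a < b)%O by rewrite
    -le_eqVlt.
    by apply: shadow_restr; exact: set_val_in.
  by rewrite /z -(yl a b lab).
have [||a b t at_ bt|x xz] :=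
    @shadow_glue R T X e hX.1 ce (coord_index op) (fun a => val a) z.
- move=> F _; exact: coord_index_cover.
- by move=> a; exact: set_val_in.
- have [_ dir] := coord_index_directed op; have [c ac bc] := dir a b.
  by rewrite -(zz a c ac) -(zz b c bc) !restr_in.
exists x; apply: set_val_inj; apply: functional_extensionality_dep => a.
by apply: set_val_inj; exact: xz.
Qed.

(** The supremum of a chain is the union of its members. *)
Lemma spectrum_sigma_complete : sigma_complete spectrum.
Proof.
move=> c cS.
have cm k : val (c k) `<=` val (c k.+1) by exact: coord_index_lt.
have [|g gE] := @coord_index_ex T op (\bigcup_k val (c k)).
  split; first by apply: bigcup_countable => // k _; case: (coord_indexP (c k)).
  by apply: op_closed_bigcup => // k; case: (coord_indexP (c k)).
have ub k : (c k < g)%O.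
  apply: lt_le_trans (cS k) _; apply/coord_index_le; rewrite gE => t ct.
  by exists k.+1.
exists g, ub; split=> [b cb|].
  by apply/coord_index_le; rewrite gE => t [k _ ct];
    move/coord_index_le: (cb k); exact.
pose q k := @bond _ _ spectrum _ _ (cS k).
have lim (x : spectrum g) : sequence_limit q (fun k => bond (ub k) x).
  by move=> k; rewrite /q -bond_comp.
pose h (x : spectrum g) : sequence_limit q :=
  exist (fun z => z \in sequence_limit q) _ (mem_set (lim x)).
exists h => //; apply: compact_homeomorphism.
- by case: (shadow_compactum (val g)).
- apply: set_type_hausdorff; apply: hausdorff_product => k.
  by case: (shadow_compactum (val (c k))).
- apply: continuous_set_type; apply: continuous_prod => k.
  exact: bond_continuous.
- move=> x y /(congr1 set_val) hxy; apply: set_val_inj.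
  rewrite -(shadow_restr (set_val_in x)) -(shadow_restr (set_val_in y)).
  apply/funext => t; have [gt|ngt] := pselect (val g t);
    last by rewrite !restr_out.
  have [k _ ct] : (\bigcup_k val (c k)) t by rewrite -gE.
  have : restr (val (c k)) (set_val x) t = restr (val (c k)) (set_val y) t :=
    congr1 (fun z : prod_topology (fun k => spectrum (c k)) => set_val (z k) t)
      hxy.
  by rewrite !restr_in.
move=> y; have yl := set_val_in y; pose z k : RT := set_val (set_val y k).
have zS k : restr (val (c k)) (z k.+1) = z k := congr1 set_val (yl k).
have zz j k : (j <= k)%N -> forall t, val (c j) t -> z k t = z j t.
  move=> /subnK <-; elim: (k - j)%N => [//|i IH] t ct.
  rewrite -(IH t ct) addSn -(zS (i + j)%N) restr_in//.
  have : (c j <= c (i + j))%O.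
    elim: {IH} i => [//|i IH]; apply: le_trans IH _.
    exact: ltW (cS (i + j)%N).
  by move/coord_index_le; exact.
have [F cF||j k t jt kt|x xz] :=
    @shadow_glue R T X e hX.1 ce nat (fun k => val (c k)) z.
- by apply: (chain_seq cm) => t /cF[k ct]; exists k.
- by move=> k; exact: set_val_in.
- by have [jk|/ltnW kj] := leqP j k; [rewrite (zz j k jk)|rewrite (zz k j kj)].
exists (to_shadow (val g) x); apply: set_val_inj.
apply: functional_extensionality_dep => k; apply: set_val_inj.
change (restr (val (c k)) (restr (val g) (e x)) = z k).
by rewrite -(xz k) restr_sub// gE => t ct; exists k.
Qed.

End spectrum.

Section realization.
Context {R : realType} (tests : topologicalType -> Prop).

Lemma box_nbd_sub (T : choiceType) (X : topologicalType) (e : X -> Rpow R T)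
    (F : seq T) (a b : R) : a <= b -> box_nbd e F a `<=` box_nbd e F b.
Proof. by move=> ab z [x xz]; exists x => t tF;
  exact: lt_le_trans (xz t tF) ab. Qed.

Definition radius (k : nat) : R := k.+1%:R^-1.

Lemma radius_gt0 k : 0 < radius k.
Proof. by rewrite /radius invr_gt0 ltr0n. Qed.

Lemma radius_small (a : R) : 0 < a -> exists k, radius k <= a.
Proof.
move=> a0; exists (Num.truncn a^-1); rewrite /radius invf_ple ?posrE ?ltr0n//.
by apply/ltW; rewrite truncnS_gt.
Qed.

(** For each basic neighborhood, given by F and k, the coordinates of a
    smaller one whose test maps contract in it are chosen. Radii range over
    a countable set so that closing a set of coordinates under this choice
    preserves countability. *)
Lemma UV_operator (T : choiceType) (X : topologicalType) (e : X -> Rpow R T) :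
  compact [set: X] -> continuous e -> UV_near R tests (range e) ->
  exists op : seq T -> nat -> seq T, forall F k, exists j,
    contracts R tests (box_nbd e (op F k) (radius j)) (box_nbd e F (radius k)).
Proof.
move=> cX ce nE.
have op_ex (i : seq T * nat) : exists F', exists j,
    contracts R tests (box_nbd e F' (radius j)) (box_nbd e i.1 (radius i.2)).
  have [V nV VU] := nE _ (@box_nbd_nbhs R T X e i.1 _ (radius_gt0 i.2)).
  have /set_nbhsP[W [oW eW WV]] := nV.
  have [F' [a [a0 F'W]]] := box_nbd_cofinal cX ce oW eW.
  have [j ja] := radius_small a0; exists F', j.
  by apply: contracts_sub VU => // z /(box_nbd_sub ja) /F'W /WV.
have [op opP] := choice op_ex.
by exists (fun F k => op (F, k)) => F k; exact: opP (F, k).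
Qed.

(** A neighborhood of the shadow over B involves finitely many coordinates
    in B. The smaller neighborhood chosen for them involves only coordinates in
    B as well, so it is also a neighborhood of the shadow. *)
Lemma shadow_UV (T : choiceType) (X : topologicalType) (e : X -> Rpow R T)
    (op : seq T -> nat -> seq T) (B : set T) :
  compact [set: X] -> continuous e ->
  (forall F k, exists j,
    contracts R tests (box_nbd e (op F k) (radius j)) (box_nbd e F (radius k)))
      ->
  op_closed op B -> UV_near R tests (shadow e B).
Proof.
move=> cX ce opP Bop; apply: UV_near_open => U oU BU.
have ceB : continuous (fun x => restr B (e x)).
  exact: (continuous_compose ce (@restr_continuous R T B)).
have [F [a [a0 FU]]] := box_nbd_cofinal cX ceB oU BU.
have [k ka] := radius_small a0.
pose FB := [seq t <- F | `[< B t >]].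
have [j VU] := opP FB k.
have FBB t : t \in FB -> B t by rewrite mem_filter => /andP[/asboolP].
apply: (UV_transfer (W := setT) (alpha := id) (beta := restr B) oU openT
  _ _ (@restr_continuous R T B) _ _ _ VU) => //.
- by move=> z _; exact: continuous_id.
- move=> z [x xz]; apply: FU; exists x => t tF.
  have [Bt|nBt] := pselect (B t); last by rewrite !restr_out// subrr normr0.
  by rewrite !restr_in// (lt_le_trans (xz t _))// mem_filter asboolT.
- move=> _ [x _ <-]; apply: open_nbhs_nbhs; split; first exact: box_nbd_open.
  exists x => t topF; rewrite restr_in ?subrr ?normr0 ?radius_gt0//.
  exact: Bop FBB _ topF.
- by move=> z t Bz _; rewrite (shadow_restr Bz) linexx; exact: BU.
Qed.

Lemma shadow_UV_shape (T : choiceType) (X : topologicalType) (e : X -> Rpow R T)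
    (B : set T) :
  (forall x, cube (e x)) -> UV_near R tests (shadow e B) ->
  UV_shape R tests (shadow e B).
Proof.
move=> eC nB; exists T, set_val; split.
- exact: set_val_continuous.
- exact: set_val_inj.
- by move=> z; have [x _ <-] := set_val_in z; exact: restr_cube.
- have -> // : range (set_val : shadow e B -> Rpow R T) = shadow e B.
  rewrite eqEsubset; split=> [_ [z _ <-]|z Bz]; first exact: set_val_in.
  by have [w wz] := set_type_ex Bz; exists w.
Qed.

Lemma UV_shape_sigma_limit (X : topologicalType) :
  compactum X -> UV_shape R tests X -> sigma_limit_of R (UV_shape R tests) X.
Proof.
move=> hX [T [e [ce ie eC nE]]].
have [op opP] := UV_operator hX.1 ce nE.
exists set_display, (coord_index op), (spectrum e op); split.
- exact: coord_index_directed.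
- exact: spectrum_sigma_complete.
- move=> a; have [cB oB] := coord_indexP a; split.
  + exact: shadow_compactum.
  + exact: (shadow_metrizable hX.1 ce cB).
  + apply: shadow_UV_shape => //; exact: (shadow_UV hX.1 ce opP oB).
- exact: spectrum_limit.
Qed.

Lemma sigma_limit_UV_shape (X : topologicalType) :
  compactum X -> sigma_limit_of R (UV_shape R tests) X -> UV_shape R tests X.
Proof.
move=> hX [d [A [S [dA _ SP [h hh]]]]].
apply: (limit_UV_shape dA _ hX hh); first by move=> a; case: (SP a).
by move=> a; case: (SP a).
Qed.

Lemma sigma_limit_of_sub (P Q : topologicalType -> Prop) (X : topologicalType) :
  (forall K, compactum K -> P K -> Q K) ->
  sigma_limit_of R P X -> sigma_limit_of R Q X.
Proof.
move=> PQ [d [A [S [dA sS SP hX]]]]; exists d, A, S; split=> // a.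
by have [cS mS pS] := SP a; split=> //; exact: PQ.
Qed.

End realization.

Theorem theorem3p3 (R : realType) (n : nat) (X : topologicalType)
    (hX : compactum X) :
  (cell_like_space R X <-> sigma_limit_of R (cell_like_space R) X) /\
  (UV_space R n X <-> sigma_limit_of R (UV_space R n) X).
Proof.
split; split.
- move=> /(cell_like_shape hX) /(UV_shape_sigma_limit hX).
  by apply: sigma_limit_of_sub; exact: shape_cell_like.
- move=> H; apply: shape_cell_like => //; apply: sigma_limit_UV_shape => //.
  by move: H; apply: sigma_limit_of_sub; exact: cell_like_shape.
- move=> /(UV_space_shape hX) /(UV_shape_sigma_limit hX).
  by apply: sigma_limit_of_sub; exact: shape_UV_space.
- move=> H; apply: shape_UV_space => //; apply: sigma_limit_UV_shape => //.
  by move: H; apply: sigma_limit_of_sub; exact: UV_space_shape.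
Qed.
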